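(* Let $\mathcal{C}$ be a multifusion category over $\Bbbk$, and let $H$ be a regular semisimple weak Hopf algebra such that $\mathcal{C}$ is equivalent to the category $\mathrm{Rep}(H)$ of finite dimensional representations of $H$. Then $H$ is connected if and only if for any non-zero $H$-module algebra $A$, the functor $-\otimes A:\mathrm{Rep}(H)\to\mathrm{Rep}(H)_A$ is separable.
   Context: $\Bbbk$ is an algebraically closed field. A multitensor category over $\Bbbk$ is a locally finite (finite-dimensional Hom spaces, all objects of finite length) $\Bbbk$-linear abelian rigid monoidal category with bilinear tensor product; a multifusion category is a finite (finitely many isomorphism classes of simple objects, enough projectives) semisimple multitensor category; a fusion category is a multifusion category with $\mathrm{End}(1)=\Bbbk$. It is known that any multifusion category is (monoidally) equivalent to $\mathrm{Rep}(H)$ for some (non-unique) finite dimensional regular semisimple weak Hopf algebra $H$ over $\Bbbk$ (it can be given as $H=\mathrm{End}(F)$ for a fiber functor $F$ from $\mathcal{C}$ to bimodules over a semisimple algebra $R$). Regular means that the square of the antipode is the identity on the subalgebra generated by the target and source counital subalgebras $H_t,H_s$. $H$ is connected if $H_t\cap Z(H)=\Bbbk$, where $Z(H)$ is the center of $H$; it is known that this holds if and only if $\mathcal{C}$ is a fusion category. An $H$-module algebra means an algebra in the monoidal category $\mathrm{Rep}(H)$. For an algebra $A$ in a monoidal category $\mathcal{E}$, $\mathcal{E}_A$ is the category of right $A$-modules in $\mathcal{E}$ and $-\otimes A:\mathcal{E}\to\mathcal{E}_A$ is $M\mapsto(M\otimes A,M\otimes m_A)$, $f\mapsto f\otimes A$.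 A functor $F:\mathcal{E}\to\mathcal{D}$ is separable if there is a natural transformation $\mathcal{P}:\mathrm{Hom}_{\mathcal{D}}(F-,F-)\to\mathrm{Hom}_{\mathcal{E}}(-,-)$ with $\mathcal{P}(F(f))=f$ for every morphism $f$ in $\mathcal{E}$. *)

(* Defs.v *)
From HB Require Import structures.
From mathcomp Require Import all_boot all_order all_algebra all_field.
From mathcomp Require Import boolp.

Set Implicit Arguments.
Unset Strict Implicit.
Unset Printing Implicit Defensive.

Import GRing.Theory VectorInternalTheory.
Local Open Scope ring_scope.

Declare Scope cat_scope.
Delimit Scope cat_scope with cat.
Local Open Scope cat_scope.

Reserved Notation "g ∘ f" (at level 40, left associativity).
Reserved Notation "X ⊗ Y" (at level 30, right associativity).
Reserved Notation "f ⊠ g" (at level 30, right associativity).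

Record category := Category {
  ob :> Type;
  mor : ob -> ob -> Type;
  idm : forall X, mor X X;
  cmp : forall X Y Z, mor Y Z -> mor X Y -> mor X Z;
  cmp1m : forall X Y (f : mor X Y), cmp (idm Y) f = f;
  cmpm1 : forall X Y (f : mor X Y), cmp f (idm X) = f;
  cmpA : forall X Y Z T (h : mor Z T) (g : mor Y Z) (f : mor X Y),
    cmp h (cmp g f) = cmp (cmp h g) f }.

Arguments mor {c} _ _.
Arguments idm {c} X.
Arguments cmp {c X Y Z} _ _.
Notation "g ∘ f" := (cmp g f) : cat_scope.

Definition inverse_mor (C : category) (X Y : C) (f : mor X Y) (g : mor Y X) :=
  g ∘ f = idm X /\ f ∘ g = idm Y.

Definition iso_mor (C : category) (X Y : C) (f : mor X Y) :=
  exists g, inverse_mor f g.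

Definition isomorphic (C : category) (X Y : C) :=
  exists f : mor X Y, iso_mor f.

Definition mono (C : category) (X Y : C) (f : mor X Y) :=
  forall T (u v : mor T X), f ∘ u = f ∘ v -> u = v.

Definition epi (C : category) (X Y : C) (f : mor X Y) :=
  forall T (u v : mor Y T), u ∘ f = v ∘ f -> u = v.

Definition zero_object (C : category) (X : C) :=
  forall Y : C, (exists! f : mor X Y, True) /\ (exists! f : mor Y X, True).

Record functor (C D : category) := Functor {
  fob :> C -> D;
  fmap : forall X Y, mor X Y -> mor (fob X) (fob Y);
  fmap1 : forall X, fmap (idm X) = idm (fob X);
  fmapM : forall X Y Z (g : mor Y Z) (f : mor X Y),
    fmap (g ∘ f) = fmap g ∘ fmap f }.

Arguments fmap {C D} f {X Y} _ : rename.

Definition separable_functor (C D : category) (F : functor C D) :=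
  exists P : forall X Y : C, mor (F X) (F Y) -> mor X Y,
    (forall X Y X' Y' (u : mor X' X) (v : mor Y Y') (h : mor (F X) (F Y)),
       P X' Y' (fmap F v ∘ h ∘ fmap F u) = v ∘ P X Y h ∘ u) /\
    (forall X Y (f : mor X Y), P X Y (fmap F f) = f).

Record monoidal (C : category) := Monoidal {
  tunit : C;
  tob : C -> C -> C;
  tmor : forall X Y X' Y', mor X X' -> mor Y Y' -> mor (tob X Y) (tob X' Y');
  tassoc : forall X Y Z, mor (tob (tob X Y) Z) (tob X (tob Y Z));
  tassocV : forall X Y Z, mor (tob X (tob Y Z)) (tob (tob X Y) Z);
  tlunit : forall X, mor (tob tunit X) X;
  tlunitV : forall X, mor X (tob tunit X);
  trunit : forall X, mor (tob X tunit) X;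
  trunitV : forall X, mor X (tob X tunit);
  tmor1 : forall X Y, tmor (idm X) (idm Y) = idm (tob X Y);
  tmorM : forall X Y X' Y' X'' Y'' (f' : mor X' X'') (f : mor X X')
      (g' : mor Y' Y'') (g : mor Y Y'),
    tmor (f' ∘ f) (g' ∘ g) = tmor f' g' ∘ tmor f g;
  tassocK : forall X Y Z, inverse_mor (tassoc X Y Z) (tassocV X Y Z);
  tlunitK : forall X, inverse_mor (tlunit X) (tlunitV X);
  trunitK : forall X, inverse_mor (trunit X) (trunitV X);
  tassoc_nat : forall X Y Z X' Y' Z'
      (f : mor X X') (g : mor Y Y') (h : mor Z Z'),
    tassoc X' Y' Z' ∘ tmor (tmor f g) h = tmor f (tmor g h) ∘ tassoc X Y Z;
  tlunit_nat : forall X X' (f : mor X X'),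
    tlunit X' ∘ tmor (idm tunit) f = f ∘ tlunit X;
  trunit_nat : forall X X' (f : mor X X'),
    trunit X' ∘ tmor f (idm tunit) = f ∘ trunit X;
  tpentagon : forall W X Y Z,
    tmor (idm W) (tassoc X Y Z) ∘ tassoc W (tob X Y) Z
      ∘ tmor (tassoc W X Y) (idm Z)
    = tassoc W X (tob Y Z) ∘ tassoc (tob W X) Y Z;
  ttriangle : forall X Y,
    tmor (idm X) (tlunit Y) ∘ tassoc X tunit Y = tmor (trunit X) (idm Y) }.

Record monCategory := MonCategory {
  mc_cat :> category;
  mc_mon : monoidal mc_cat }.

Definition un (E : monCategory) : E := tunit (mc_mon E).
Definition ten (E : monCategory) (X Y : E) : E := tob (mc_mon E) X Y.
Definition tenm (E : monCategory) (X Y X' Y' : E) (f : mor X X') (g : mor Y Y')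
  : mor (ten X Y) (ten X' Y') := tmor (mc_mon E) f g.
Definition assoc (E : monCategory) (X Y Z : E)
  : mor (ten (ten X Y) Z) (ten X (ten Y Z)) := tassoc (mc_mon E) X Y Z.
Definition assocV (E : monCategory) (X Y Z : E)
  : mor (ten X (ten Y Z)) (ten (ten X Y) Z) := tassocV (mc_mon E) X Y Z.
Definition lunit (E : monCategory) (X : E) : mor (ten (un E) X) X :=
  tlunit (mc_mon E) X.
Definition lunitV (E : monCategory) (X : E) : mor X (ten (un E) X) :=
  tlunitV (mc_mon E) X.
Definition runit (E : monCategory) (X : E) : mor (ten X (un E)) X :=
  trunit (mc_mon E) X.
Definition runitV (E : monCategory) (X : E) : mor X (ten X (un E)) :=
  trunitV (mc_mon E) X.

Notation "X ⊗ Y" := (ten X Y) : cat_scope.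
Notation "f ⊠ g" := (tenm f g) : cat_scope.

Section MonoidalTheory.
Variable E : monCategory.
Implicit Types X Y Z : E.

Lemma tenm1 X Y : idm X ⊠ idm Y = idm (X ⊗ Y).
Proof. exact: tmor1. Qed.

Lemma tenmM X Y X' Y' X'' Y'' (f' : mor X' X'') (f : mor X X')
    (g' : mor Y' Y'') (g : mor Y Y') :
  (f' ∘ f) ⊠ (g' ∘ g) = (f' ⊠ g') ∘ (f ⊠ g).
Proof. exact: tmorM. Qed.

Lemma tenmMl X X' X'' Y (f' : mor X' X'') (f : mor X X') :
  (f' ∘ f) ⊠ idm Y = (f' ⊠ idm Y) ∘ (f ⊠ idm Y).
Proof. by rewrite -tenmM cmp1m. Qed.

Lemma tenmMr X X' X'' Y (f' : mor X' X'') (f : mor X X') :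
  idm Y ⊠ (f' ∘ f) = (idm Y ⊠ f') ∘ (idm Y ⊠ f).
Proof. by rewrite -tenmM cmp1m. Qed.

Lemma assoc_nat X Y Z X' Y' Z' (f : mor X X') (g : mor Y Y') (h : mor Z Z') :
  assoc X' Y' Z' ∘ ((f ⊠ g) ⊠ h) = (f ⊠ (g ⊠ h)) ∘ assoc X Y Z.
Proof. exact: tassoc_nat. Qed.

Lemma runit_nat X X' (f : mor X X') :
  runit X' ∘ (f ⊠ idm (un E)) = f ∘ runit X.
Proof. exact: trunit_nat. Qed.

Lemma pentagon W X Y Z :
  (idm W ⊠ assoc X Y Z) ∘ assoc W (X ⊗ Y) Z ∘ (assoc W X Y ⊠ idm Z)
  = assoc W X (Y ⊗ Z) ∘ assoc (W ⊗ X) Y Z.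
Proof. exact: tpentagon. Qed.

Lemma triangle X Y :
  (idm X ⊠ lunit Y) ∘ assoc X (un E) Y = runit X ⊠ idm Y.
Proof. exact: ttriangle. Qed.

Lemma assocK X Y Z : assocV X Y Z ∘ assoc X Y Z = idm ((X ⊗ Y) ⊗ Z).
Proof. by case: (tassocK (mc_mon E) X Y Z). Qed.

Lemma runitK X : runitV X ∘ runit X = idm (X ⊗ un E).
Proof. by case: (trunitK (mc_mon E) X). Qed.

Lemma runitVK X : runit X ∘ runitV X = idm X.
Proof. by case: (trunitK (mc_mon E) X). Qed.

Lemma runit_inj X Y (f g : mor X Y) :
  f ⊠ idm (un E) = g ⊠ idm (un E) -> f = g.
Proof.
move=> e; have : runit Y ∘ (f ⊠ idm (un E)) = runit Y ∘ (g ⊠ idm (un E)).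
  by rewrite e.
rewrite !runit_nat => e'.
by rewrite -(cmpm1 f) -(cmpm1 g) -(runitVK X) !cmpA e'.
Qed.

Lemma runit_assoc X Y :
  (idm X ⊠ runit Y) ∘ assoc X Y (un E) = runit (X ⊗ Y).
Proof.
apply: runit_inj; set I := un E.
suff e : assoc X Y I ∘ (((idm X ⊠ runit Y) ∘ assoc X Y I) ⊠ idm I) =
         assoc X Y I ∘ (runit (X ⊗ Y) ⊠ idm I).
  rewrite -(cmp1m (_ ⊠ idm I)) -[RHS]cmp1m -(assocK X Y I) -!cmpA.
  by congr (_ ∘ _).
rewrite tenmMl cmpA assoc_nat -!triangle -/I tenmMr.
rewrite -cmpA (cmpA _ _ (_ ⊠ _)).
have := pentagon X Y I I; rewrite -!cmpA => ->.
by rewrite !cmpA -assoc_nat tenm1.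
Qed.

Record algebra := Algebra {
  alg_ob :> E;
  alg_mul : mor (alg_ob ⊗ alg_ob) alg_ob;
  alg_one : mor (un E) alg_ob;
  alg_mulA : alg_mul ∘ (alg_mul ⊠ idm alg_ob)
    = alg_mul ∘ (idm alg_ob ⊠ alg_mul) ∘ assoc alg_ob alg_ob alg_ob;
  alg_mul1m : alg_mul ∘ (alg_one ⊠ idm alg_ob) = lunit alg_ob;
  alg_mulm1 : alg_mul ∘ (idm alg_ob ⊠ alg_one) = runit alg_ob }.

Variable A : algebra.

Record rmodule := RModule {
  rm_ob :> E;
  rm_act : mor (rm_ob ⊗ A) rm_ob;
  rm_actA : rm_act ∘ (rm_act ⊠ idm (A : E))
    = rm_act ∘ (idm rm_ob ⊠ alg_mul A) ∘ assoc rm_ob A A;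
  rm_act1 : rm_act ∘ (idm rm_ob ⊠ alg_one A) = runit rm_ob }.

Record rmodule_mor (M N : rmodule) := RModuleMor {
  rmm_mor :> mor (M : E) N;
  rmm_act : rmm_mor ∘ rm_act M = rm_act N ∘ (rmm_mor ⊠ idm (A : E)) }.

Lemma rmodule_morP (M N : rmodule) (f g : rmodule_mor M N) :
  rmm_mor f = rmm_mor g -> f = g.
Proof.
by case: f g => f hf [g hg] /= e; subst g; rewrite (Prop_irrelevance hf hg).
Qed.

Lemma rmodule_idm_subproof (M : rmodule) :
  idm (M : E) ∘ rm_act M = rm_act M ∘ (idm (M : E) ⊠ idm (A : E)).
Proof. by rewrite cmp1m tenm1 cmpm1. Qed.

Lemma rmodule_cmp_subproof (M N P : rmodule)
    (g : rmodule_mor N P) (f : rmodule_mor M N) :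
  (g ∘ f) ∘ rm_act M = rm_act P ∘ ((g ∘ f) ⊠ idm (A : E)).
Proof. by rewrite tenmMl -cmpA rmm_act cmpA rmm_act cmpA. Qed.

Definition rmodule_cat : category.
Proof.
refine (@Category rmodule rmodule_mor
  (fun M => RModuleMor (rmodule_idm_subproof M))
  (fun M N P g f => RModuleMor (rmodule_cmp_subproof g f)) _ _ _).
- by move=> M N f; apply: rmodule_morP; apply: cmp1m.
- by move=> M N f; apply: rmodule_morP; apply: cmpm1.
- by move=> M N P Q h g f; apply: rmodule_morP; apply: cmpA.
Defined.

Definition free_act (M : E) : mor ((M ⊗ A) ⊗ A) (M ⊗ A) :=
  (idm M ⊠ alg_mul A) ∘ assoc M A A.

Lemma free_actA M : free_act M ∘ (free_act M ⊠ idm (A : E))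
  = free_act M ∘ (idm (M ⊗ A) ⊠ alg_mul A) ∘ assoc (M ⊗ A) A A.
Proof.
rewrite /free_act tenmMl -(cmpA (idm M ⊠ alg_mul A)) (cmpA (assoc M A A)).
rewrite assoc_nat -!cmpA.
rewrite (cmpA (idm M ⊠ alg_mul A)) -tenmMr alg_mulA.
rewrite tenmMr -!cmpA.
have := pentagon M A A A; rewrite -!cmpA => e; rewrite [X in _ ∘ X]cmpA.
rewrite -[X in X ∘ _]cmp1m.
rewrite cmp1m -!cmpA [X in X ∘ (_ ∘ _)]tenmMr -!cmpA e.
by congr (_ ∘ _); rewrite !cmpA -assoc_nat tenm1.
Qed.

Lemma free_act1 M : free_act M ∘ (idm (M ⊗ A) ⊠ alg_one A) = runit (M ⊗ A).
Proof.
rewrite /free_act -cmpA -tenm1 assoc_nat cmpA -tenmMr alg_mulm1.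
exact: runit_assoc.
Qed.

Definition free_rmodule (M : E) : rmodule := RModule (free_actA M) (free_act1 M).

Lemma free_mor_subproof (M N : E) (f : mor M N) :
  (f ⊠ idm (A : E)) ∘ free_act M
  = free_act N ∘ ((f ⊠ idm (A : E)) ⊠ idm (A : E)).
Proof.
rewrite /free_act -[RHS]cmpA assoc_nat tenm1 !cmpA -!tenmM.
by rewrite !cmp1m !cmpm1.
Qed.

Definition free_functor : functor E rmodule_cat.
Proof.
refine (@Functor E rmodule_cat free_rmodule
  (fun M N f => @RModuleMor (free_rmodule M) (free_rmodule N)
     (f ⊠ idm (A : E)) (free_mor_subproof f)) _ _).
- by move=> M; apply: rmodule_morP; apply: tenm1.
- by move=> M N P g f; apply: rmodule_morP; apply: tenmMl.
Defined.

End MonoidalTheory.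

Record linCategory (k : fieldType) := LinCategory {
  lob : Type;
  lmor : lob -> lob -> lmodType k;
  lid : forall X, lmor X X;
  lcmp : forall X Y Z, lmor Y Z -> lmor X Y -> lmor X Z;
  lcmp1m : forall X Y (f : lmor X Y), lcmp (lid Y) f = f;
  lcmpm1 : forall X Y (f : lmor X Y), lcmp f (lid X) = f;
  lcmpA : forall X Y Z T (h : lmor Z T) (g : lmor Y Z) (f : lmor X Y),
    lcmp h (lcmp g f) = lcmp (lcmp h g) f;
  lcmp_linearl : forall X Y Z (f : lmor X Y),
    linear (fun g : lmor Y Z => lcmp g f);
  lcmp_linearr : forall X Y Z (g : lmor Y Z),
    linear (fun f : lmor X Y => lcmp g f) }.

Definition lin_cat (k : fieldType) (C : linCategory k) : category :=
  @Category (lob C) (@lmor k C) (@lid k C) (@lcmp k C)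
    (@lcmp1m k C) (@lcmpm1 k C) (@lcmpA k C).
Coercion lin_cat : linCategory >-> category.

Record linMonCategory (k : fieldType) := LinMonCategory {
  lm_lin :> linCategory k;
  lm_mon : monoidal lm_lin }.

Definition lm_monCat (k : fieldType) (C : linMonCategory k) : monCategory :=
  MonCategory (lm_mon C).
Coercion lm_monCat : linMonCategory >-> monCategory.
Canonical lm_monCat.

Section LinearNotions.
Variables (k : fieldType) (C : linCategory k).
Implicit Types X Y Z : C.

Definition lzero X Y : mor X Y := (0 : lmor X Y).
Definition ladd X Y (f g : mor X Y) : mor X Y := ((f : lmor X Y) + g)%R.

Definition is_kernel X Y K (f : mor X Y) (i : mor K X) :=
  f ∘ i = lzero K Y /\
  forall T (g : mor T X), f ∘ g = lzero T Y -> exists! u : mor T K, i ∘ u = g.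

Definition is_cokernel X Y Q (f : mor X Y) (p : mor Y Q) :=
  p ∘ f = lzero X Q /\
  forall T (g : mor Y T), g ∘ f = lzero X T -> exists! u : mor Q T, u ∘ p = g.

Definition is_biproduct X Y Z :=
  exists (i1 : mor X Z) (i2 : mor Y Z) (p1 : mor Z X) (p2 : mor Z Y),
    [/\ p1 ∘ i1 = idm X, p2 ∘ i2 = idm Y, p1 ∘ i2 = lzero Y X,
        p2 ∘ i1 = lzero X Y & ladd (i1 ∘ p1) (i2 ∘ p2) = idm Z].

Definition abelian_cat :=
  (exists X, zero_object X) /\
  (forall X Y, exists Z, is_biproduct X Y Z) /\
  (forall X Y (f : mor X Y), exists K (i : mor K X), is_kernel f i) /\
  (forall X Y (f : mor X Y), exists Q (p : mor Y Q), is_cokernel f p) /\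
  (forall X Y (i : mor X Y), mono i ->
     exists Z (f : mor Y Z), is_kernel f i) /\
  (forall X Y (p : mor X Y), epi p ->
     exists Z (f : mor Z X), is_cokernel f p).

Definition simple_object X :=
  ~ zero_object X /\
  forall Y (i : mor Y X), mono i -> zero_object Y \/ iso_mor i.

Definition short_exact X Y Z (i : mor X Y) (p : mor Y Z) :=
  is_kernel p i /\ is_cokernel i p.

Inductive finite_length : C -> Prop :=
| finite_length0 X : zero_object X -> finite_length X
| finite_lengthS X Y S (i : mor X Y) (p : mor Y S) :
    short_exact i p -> finite_length X -> simple_object S -> finite_length Y.

Definition finite_dim (V : lmodType k) :=
  exists n (e : 'I_n -> V), forall v, exists c : 'I_n -> k,
    v = (\sum_(i < n) c i *: e i)%R.

Definition locally_finite :=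
  (forall X Y, finite_dim (lmor X Y)) /\ (forall X, finite_length X).

Definition projective_object (P : C) :=
  forall Y Z (e : mor Y Z) (f : mor P Z), epi e -> exists g, e ∘ g = f.

Definition enough_projectives :=
  forall X, exists (P : C) (e : mor P X), projective_object P /\ epi e.

Definition finitely_many_simples :=
  exists n (S : 'I_n -> C), (forall i, simple_object (S i)) /\
    forall X, simple_object X -> exists i, isomorphic X (S i).

Definition finite_cat := finitely_many_simples /\ enough_projectives.

Definition is_direct_sum n (S : 'I_n -> C) X :=
  exists (j : forall i, mor (S i) X) (p : forall i, mor X (S i)),
    [/\ forall i, p i ∘ j i = idm (S i),
        forall a b, a != b -> p a ∘ j b = lzero (S b) (S a) &
        (\sum_(i < n) (j i ∘ p i : lmor X X))%R = idm X].

Definition semisimple_cat :=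
  forall X, exists n (S : 'I_n -> C),
    (forall i, simple_object (S i)) /\ is_direct_sum S X.

End LinearNotions.

Section Rigid.
Variable E : monCategory.
Implicit Types X Y : E.

(* Y is a left dual of X, hence X is a right dual of Y. *)
Definition is_left_dual X Y :=
  exists (ev : mor (Y ⊗ X) (un E)) (coev : mor (un E) (X ⊗ Y)),
    runit X ∘ (idm X ⊠ ev) ∘ assoc X Y X ∘ (coev ⊠ idm X) ∘ lunitV X = idm X /\
    lunit Y ∘ (ev ⊠ idm Y) ∘ assocV Y X Y ∘ (idm Y ⊠ coev) ∘ runitV Y = idm Y.

Definition rigid :=
  forall X, (exists Y, is_left_dual X Y) /\ (exists Y, is_left_dual Y X).

End Rigid.

Section Multifusion.
Variables (k : fieldType) (C : linMonCategory k).

Definition bilinear_tensor :=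
  (forall (X X' Y Y' : C) (g : mor Y Y'),
     linear (fun f : lmor X X' => (f : mor X X') ⊠ g : lmor (X ⊗ Y) (X' ⊗ Y'))) /\
  (forall (X X' Y Y' : C) (f : mor X X'),
     linear (fun g : lmor Y Y' => f ⊠ (g : mor Y Y') : lmor (X ⊗ Y) (X' ⊗ Y'))).

Definition multitensor :=
  [/\ abelian_cat C, locally_finite C, rigid C & bilinear_tensor].

Definition multifusion := [/\ multitensor, finite_cat C & semisimple_cat C].

End Multifusion.

Section MonoidalEquivalence.
Variables (k : fieldType) (C D : linMonCategory k).

Definition linear_functor (F : functor C D) :=
  forall X Y : C, linear (fun f : lmor X Y => fmap F (f : mor X Y) : lmor (F X) (F Y)).

Definition strong_monoidal (F : functor C D) :=
  exists (phi : forall X Y : C, mor (F X ⊗ F Y) (F (X ⊗ Y)))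
         (phi0 : mor (un D) (F (un C))),
  [/\ (forall X Y, iso_mor (phi X Y)) /\ iso_mor phi0,
      forall X Y X' Y' (f : mor X X') (g : mor Y Y'),
        fmap F (f ⊠ g) ∘ phi X Y = phi X' Y' ∘ (fmap F f ⊠ fmap F g),
      forall X Y Z,
        fmap F (assoc X Y Z) ∘ phi (X ⊗ Y) Z ∘ (phi X Y ⊠ idm (F Z))
        = phi X (Y ⊗ Z) ∘ (idm (F X) ⊠ phi Y Z) ∘ assoc (F X) (F Y) (F Z),
      forall X, fmap F (lunit X) ∘ phi (un C) X ∘ (phi0 ⊠ idm (F X))
        = lunit (F X) &
      forall X, fmap F (runit X) ∘ phi X (un C) ∘ (idm (F X) ⊠ phi0)
        = runit (F X)].

Definition equivalence (F : functor C D) :=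
  (forall (X Y : C), bijective (fun f : mor X Y => fmap F f)) /\
  (forall Y : D, exists X : C, isomorphic (F X) Y).

Definition monoidally_equivalent :=
  exists F : functor C D,
    [/\ linear_functor F, strong_monoidal F & equivalence F].

End MonoidalEquivalence.

Local Close Scope cat_scope.

(* Convertible to linear; a constant that the tactic lin below can match on. *)
Definition lin (k : fieldType) (V W : lmodType k) (f : V -> W) :=
  forall c x y, f (c *: x + y) = c *: f x + f y.

Lemma linZ (k : fieldType) (V W : lmodType k) (f : V -> W) c x :
  lin f -> f (c *: x) = c *: f x.
Proof.
move=> hf; have f0 : f 0 = 0.
  by have := hf (-1) 0 0; rewrite scaler0 addr0 scaleN1r addNr.
by have := hf c x 0; rewrite f0 !addr0.
Qed.

Lemma lin_sum (k : fieldType) (V W : lmodType k) (f : V -> W) (I : finType)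
    (c : I -> k) (x : I -> V) :
  lin f -> f (\sum_i c i *: x i) = \sum_i c i *: f (x i).
Proof.
move=> hf; have -> : f (\sum_i c i *: x i) = \sum_i f (c i *: x i).
  apply: big_morph => [y z|]; first by have := hf 1 y z; rewrite !scale1r.
  by rewrite -(scale0r 0) linZ // !scale0r.
by apply: eq_bigr => i _; rewrite linZ.
Qed.

Lemma linfunE_lin (k : fieldType) (V W : vectType k) (f : V -> W) :
  lin f -> linfun f =1 f.
Proof.
move=> hf v; pose M := GRing.isLinear.Build k V W *:%R f hf.
pose F : {linear V -> W} := HB.pack f M.
by rewrite (lfunE F).
Qed.

(* v (x) w is modelled by the matrix of products of the coordinates of v and w
   in the bases provided by the vectType structures. *)
Definition tens (k : fieldType) (V W : vectType k) : vectType k :=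
  'M[k]_(dim V, dim W).

Section TensorProduct.
Variable k : fieldType.

Definition tpure (V W : vectType k) (v : V) (w : W) : tens V W :=
  ((v2r v)^T *m v2r w : 'M[k]_(dim V, dim W)).

Definition tbase (V : vectType k) (i : 'I_(dim V)) : V := r2v (delta_mx 0 i).

(* For bilinear f, tlift f is the linear map with v (x) w |-> f v w. *)
Definition tlift (V W : vectType k) (U : lmodType k) (f : V -> W -> U)
    (t : tens V W) : U :=
  \sum_(i < dim V) \sum_(j < dim W)
    (t : 'M[k]_(dim V, dim W)) i j *: f (tbase i) (tbase j).

Variables V W : vectType k.

Lemma tbase_sum (X : vectType k) (v : X) : v = \sum_i v2r v 0 i *: tbase i.
Proof.
rewrite -[LHS]v2rK [v2r v in LHS]row_sum_delta linear_sum; apply: eq_bigr => i _.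
by rewrite linearZ.
Qed.

Lemma tlift_is_lin (U : lmodType k) (f : V -> W -> U) : lin (tlift f).
Proof.
move=> c s t; rewrite /tlift scaler_sumr -big_split; apply: eq_bigr => i _.
rewrite scaler_sumr -big_split; apply: eq_bigr => j _ /=.
by rewrite !mxE scalerDl scalerA.
Qed.

Lemma tlift_pure (U : lmodType k) (f : V -> W -> U) v w :
  (forall y, lin (fun x => f x y)) -> (forall x, lin (fun y => f x y)) ->
  tlift f (tpure v w) = f v w.
Proof.
move=> fl fr; rewrite [v in RHS]tbase_sum [w in RHS]tbase_sum.
rewrite (lin_sum _ _ (fl _)); apply: eq_bigr => i _.
rewrite (lin_sum _ _ (fr _)) scaler_sumr; apply: eq_bigr => j _.
by rewrite scalerA; congr (_ *: _); rewrite /tpure !mxE big_ord1 mxE.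
Qed.

Lemma tpure_linl (w : W) : lin (fun v : V => tpure v w).
Proof. by move=> c x y; rewrite /tpure linearP /= linearP /= mulmxDl -scalemxAl. Qed.

Lemma tpure_linr (v : V) : lin (fun w : W => tpure v w).
Proof. by move=> c x y; rewrite /tpure linearP /= mulmxDr -scalemxAr. Qed.

Lemma tens_span (t : tens V W) : tlift (@tpure V W) t = t.
Proof.
rewrite /tlift [RHS]matrix_sum_delta; apply: eq_bigr => i _.
apply: eq_bigr => j _; congr (_ *: _).
by rewrite /tpure /tbase !r2vK trmx_delta mul_delta_mx.
Qed.

Lemma eq_tlift (U : lmodType k) (f g : V -> W -> U) t :
  (forall v w, f v w = g v w) -> tlift f t = tlift g t.
Proof.
move=> e; apply: eq_bigr => i _; apply: eq_bigr => j _; by rewrite e.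
Qed.

Lemma tlift_lin (U U' : lmodType k) (g : U -> U') (f : V -> W -> U) t :
  lin g -> g (tlift f t) = tlift (fun v w => g (f v w)) t.
Proof.
move=> hg; rewrite /tlift !pair_bigA /=; exact: (lin_sum _ _ hg).
Qed.

Lemma tens_ext (U : lmodType k) (f g : tens V W -> U) :
  lin f -> lin g -> (forall v w, f (tpure v w) = g (tpure v w)) -> f =1 g.
Proof.
move=> hf hg e t; rewrite -(tens_span t) !tlift_lin //.
exact: eq_tlift.
Qed.

End TensorProduct.

Lemma tliftC (k : fieldType) (V W V' W' : vectType k) (U : lmodType k)
    (f : V -> W -> V' -> W' -> U) s t :
  tlift (fun a b => tlift (fun c d => f a b c d) t) s =
  tlift (fun c d => tlift (fun a b => f a b c d) s) t.
Proof.
rewrite /tlift !pair_bigA /=.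
under eq_bigr => p _ do rewrite pair_bigA scaler_sumr.
rewrite exchange_big; apply: eq_bigr => p _ /=.
rewrite pair_bigA scaler_sumr; apply: eq_bigr => q _ /=.
by rewrite !scalerA mulrC.
Qed.

(* Sweedler sums: \sw_(a, b <- t) F is "F (t_(1), t_(2))". *)
Notation "\sw_ ( a , b <- t ) F" := (tlift (fun a b => F) t)
  (at level 41, F at level 41, a name, b name, t at level 50,
   format "\sw_ ( a ,  b  <-  t )  F") : ring_scope.
Notation "v *t w" := (tpure v w) (at level 38) : ring_scope.

Section LinClosure.
Variable k : fieldType.
Implicit Types U V W X Y : vectType k.

Lemma lin_id (V : lmodType k) : lin (fun x : V => x).
Proof. by []. Qed.

Lemma lin_comp (U V W : lmodType k) (g : V -> W) (f : U -> V) :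
  lin g -> lin f -> lin (fun x => g (f x)).
Proof. by move=> hg hf c x y; rewrite hf hg. Qed.

Lemma lin_hom V W (g : 'Hom(V, W)) : lin (fun x => g x).
Proof. by move=> c x y; rewrite linearP. Qed.

Lemma lin_homl (U : lmodType k) V W (f : U -> 'Hom(V, W)) v :
  lin f -> lin (fun x => f x v).
Proof. by move=> hf c x y; rewrite hf !lfunE /= lfunE. Qed.

Lemma lin_scaler (U V : lmodType k) c (f : U -> V) :
  lin f -> lin (fun x => c *: f x).
Proof. by move=> hf d x y; rewrite hf scalerDr !scalerA mulrC. Qed.

Lemma lin_scalel (U V : lmodType k) (f : U -> k^o) (v : V) :
  lin f -> lin (fun x => f x *: v).
Proof. by move=> hf d x y; rewrite hf scalerDl scalerA. Qed.

Lemma lin_mulr (U : lmodType k) (A : falgType k) (a : A) (f : U -> A) :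
  lin f -> lin (fun x => a * f x).
Proof. by move=> hf d x y; rewrite hf mulrDr scalerAr. Qed.

Lemma lin_mull (U : lmodType k) (A : falgType k) (a : A) (f : U -> A) :
  lin f -> lin (fun x => f x * a).
Proof. by move=> hf d x y; rewrite hf mulrDl scalerAl. Qed.

Lemma lin_mulro (U : lmodType k) (a : k^o) (f : U -> k^o) :
  lin f -> lin (fun x => a * f x).
Proof. by move=> hf d x y; rewrite hf mulrDr scalerAr. Qed.

Lemma lin_mullo (U : lmodType k) (a : k^o) (f : U -> k^o) :
  lin f -> lin (fun x => f x * a).
Proof. by move=> hf d x y; rewrite hf mulrDl scalerAl. Qed.

Lemma lin_add (U V : lmodType k) (f g : U -> V) :
  lin f -> lin g -> lin (fun x => f x + g x).
Proof. by move=> hf hg c x y; rewrite hf hg scalerDr addrACA. Qed.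

Lemma lin_opp (U V : lmodType k) (f : U -> V) :
  lin f -> lin (fun x => - f x).
Proof. by move=> hf c x y; rewrite hf opprD scalerN. Qed.

Lemma lin_tpurer (U : lmodType k) V W (v : V) (f : U -> W) :
  lin f -> lin (fun x => v *t f x).
Proof. by move=> hf c x y; rewrite hf tpure_linr. Qed.

Lemma lin_tpurel (U : lmodType k) V W (w : W) (f : U -> V) :
  lin f -> lin (fun x => f x *t w).
Proof. by move=> hf c x y; rewrite hf tpure_linl. Qed.

Lemma lin_tlift (U X : lmodType k) V W (F : V -> W -> X) (f : U -> tens V W) :
  lin f -> lin (fun x => tlift F (f x)).
Proof. by move=> hf c x y; rewrite hf tlift_is_lin. Qed.

Lemma lin_tliftF (U X : lmodType k) V W (F : U -> V -> W -> X) (t : tens V W) :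
  (forall a b, lin (fun x => F x a b)) -> lin (fun x => tlift (F x) t).
Proof.
move=> hF c x y; rewrite /tlift scaler_sumr -big_split; apply: eq_bigr => i _.
rewrite scaler_sumr -big_split; apply: eq_bigr => j _ /=.
by rewrite hF scalerDr !scalerA mulrC.
Qed.

Lemma lin_linfun (U : lmodType k) V W (F : U -> V -> W) :
  (forall x, lin (F x)) -> (forall v, lin (fun x => F x v)) ->
  lin (fun x => linfun (F x)).
Proof.
move=> h1 h2 c x y; apply/lfunP => v.
by rewrite !lfunE /= !lfunE /= !linfunE_lin // h2.
Qed.

Lemma lin_vsval V (P : {vspace V}) : lin (fun x : subvs_of P => vsval x).
Proof. by []. Qed.

Lemma lin_vsproj V (P : {vspace V}) : lin (vsproj P).
Proof. by move=> c x y; rewrite linearP. Qed.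

End LinClosure.

Ltac lin_step :=
  match goal with
  | |- forall _, _ => intro; cbv beta
  | |- lin (GRing.mul _) => apply: (lin_mulr _ (f := fun x => x))
  | |- lin (fun_of_lfun _) => exact: lin_hom
  | |- lin (@tpure _ _ _ _) => exact: tpure_linr
  | |- lin (@tlift _ _ _ _ _) => exact: tlift_is_lin
  | |- lin (@vsval _ _ _) => exact: lin_vsval
  | |- lin (@vsproj _ _ _) => exact: lin_vsproj
  | |- lin (fun x => x) => exact: lin_id
  | |- lin (fun x => @tpure _ _ _ ?v (@?f x)) => apply: (@lin_tpurer _ _ _ _ v f)
  | |- lin (fun x => @tpure _ _ _ (@?f x) ?v) => apply: (@lin_tpurel _ _ _ _ v f)
  | |- lin (fun x => @tlift _ _ _ _ ?F (@?f x)) => apply: (@lin_tlift _ _ _ _ _ F f)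
  | |- lin (fun x => @tlift _ _ _ _ (@?F x) ?t) => apply: (@lin_tliftF _ _ _ _ _ F t)
  | |- lin (fun x => linfun (@?F x)) => apply: (@lin_linfun _ _ _ _ F)
  | |- lin (fun x => @vsval _ _ _ (@?f x)) => apply: (lin_comp (@lin_vsval _ _ _) (f := f))
  | |- lin (fun x => @vsproj _ _ _ (@?f x)) => apply: (lin_comp (@lin_vsproj _ _ _) (f := f))
  | |- lin (fun x => (@?f x) + (@?g x)) => apply: (@lin_add _ _ _ f g)
  | |- lin (fun x => - (@?f x)) => apply: (@lin_opp _ _ _ f)
  | |- lin (fun x => ?c *: (@?f x)) => apply: (@lin_scaler _ _ _ c f)
  | |- lin (fun x => (@?f x) *: ?c) => apply: (@lin_scalel _ _ _ f c)
  | |- lin (fun x => (@?f x) * (@?g x)) =>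
      first [apply: (@lin_mulr _ _ _ _ g) | apply: (@lin_mull _ _ _ _ f)
            | apply: (@lin_mulro _ _ _ g) | apply: (@lin_mullo _ _ _ f)]
  | |- lin (fun x => fun_of_lfun ?g (@?f x)) => apply: (lin_comp (lin_hom g) (f := f))
  | |- lin (fun x => fun_of_lfun (@?f x) ?v) => apply: (@lin_homl _ _ _ _ f v)
  | H : forall z, lin (@?g z) |- lin _ => apply: H
  | H : forall y z, lin (@?g y z) |- lin _ => apply: H
  | H : lin ?g |- lin (fun x => ?g (@?f x)) => apply: (lin_comp (g := g) (f := f) H)
  | H : forall z, lin (@?g z) |- lin _ => refine (lin_comp (H _) _)
  | H : forall y z, lin (@?g y z) |- lin _ => refine (lin_comp (H _ _) _)
  | |- _ => done
  end.
Ltac lin := cbv beta; repeat lin_step.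

(* As falgType algebras are nonzero, the zero algebra is not a weak Hopf algebra
   here.  Both iterated coproducts below are in H (x) (H (x) H). *)
Record weakHopf (k : fieldType) := WeakHopf {
  wh_alg :> falgType k;
  wh_cop : 'Hom(wh_alg, tens wh_alg wh_alg);
  wh_eps : 'Hom(wh_alg, k^o);
  wh_S : 'End(wh_alg);
  wh_copA : forall h,
    \sw_(a, b <- wh_cop h) \sw_(c, d <- wh_cop a) c *t (d *t b) =
    \sw_(a, b <- wh_cop h) \sw_(c, d <- wh_cop b) a *t (c *t d);
  wh_counitl : forall h, \sw_(a, b <- wh_cop h) wh_eps a *: b = h;
  wh_counitr : forall h, \sw_(a, b <- wh_cop h) wh_eps b *: a = h;
  wh_copM : forall g h, wh_cop (g * h) =
    \sw_(a, b <- wh_cop g) \sw_(c, d <- wh_cop h) (a * c) *t (b * d);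
  wh_epsM12 : forall f g h, wh_eps (f * g * h) =
    \sw_(a, b <- wh_cop g) (wh_eps (f * a) * wh_eps (b * h));
  wh_epsM21 : forall f g h, wh_eps (f * g * h) =
    \sw_(a, b <- wh_cop g) (wh_eps (f * b) * wh_eps (a * h));
  wh_cop1_12 :
    \sw_(a, b <- wh_cop 1) \sw_(c, d <- wh_cop b) a *t (c *t d) =
    \sw_(a, b <- wh_cop 1) \sw_(c, d <- wh_cop 1) a *t ((b * c) *t d);
  wh_cop1_21 :
    \sw_(a, b <- wh_cop 1) \sw_(c, d <- wh_cop b) a *t (c *t d) =
    \sw_(a, b <- wh_cop 1) \sw_(c, d <- wh_cop 1) a *t ((c * b) *t d);
  wh_Sr : forall h, \sw_(a, b <- wh_cop h) a * wh_S b =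
    \sw_(a, b <- wh_cop 1) wh_eps (a * h) *: b;
  wh_Sl : forall h, \sw_(a, b <- wh_cop h) wh_S a * b =
    \sw_(a, b <- wh_cop 1) wh_eps (h * b) *: a;
  wh_SS : forall h,
    \sw_(a, b <- wh_cop h) \sw_(c, d <- wh_cop b) wh_S a * c * wh_S d =
    wh_S h }.

Section WeakHopfTheory.
Variables (k : fieldType) (H : weakHopf k).
Local Notation Δ := (wh_cop H).
Local Notation ε := (wh_eps H).
Implicit Types (U : lmodType k) (V : vectType k) (f g h y z : H).

Definition eps_t : 'End(H) :=
  linfun (fun h : H => \sw_(a, b <- Δ 1) ε (a * h) *: b).
Definition eps_s : 'End(H) :=
  linfun (fun h : H => \sw_(a, b <- Δ 1) ε (h * b) *: a).

Definition target : {vspace H} := limg eps_t.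
Definition source : {vspace H} := limg eps_s.

Lemma eps_tE h : eps_t h = \sw_(a, b <- Δ 1) ε (a * h) *: b.
Proof. by rewrite /eps_t linfunE_lin //; lin. Qed.

Lemma sw_copA U (F : H -> H -> H -> U) h :
  (forall y z, lin (fun x => F x y z)) ->
  (forall x z, lin (fun y => F x y z)) ->
  (forall x y, lin (fun z => F x y z)) ->
  \sw_(a, b <- Δ h) \sw_(c, d <- Δ a) F c d b =
  \sw_(a, b <- Δ h) \sw_(c, d <- Δ b) F a c d.
Proof.
move=> F1 F2 F3; have := congr1 (tlift (fun x t => tlift (F x) t)) (wh_copA h).
rewrite !(tlift_lin _ _ (@tlift_is_lin _ _ _ _ _)).
have e (s : H -> H -> tens H H) (x y z : H -> H -> H -> H -> H) :
  \sw_(a, b <- Δ h) tlift (fun x t => tlift (F x) t)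
    (\sw_(c, d <- s a b) x a b c d *t (y a b c d *t z a b c d)) =
  \sw_(a, b <- Δ h) \sw_(c, d <- s a b) F (x a b c d) (y a b c d) (z a b c d).
  apply: eq_tlift => a b; rewrite (tlift_lin _ _ (@tlift_is_lin _ _ _ _ _)).
  by apply: eq_tlift => c d; rewrite !tlift_pure; lin.
by rewrite (e (fun a b => Δ a)) (e (fun a b => Δ b)).
Qed.

Lemma sw_copM U (F : H -> H -> U) g h :
  (forall y, lin (fun x => F x y)) -> (forall x, lin (fun y => F x y)) ->
  \sw_(a, b <- Δ (g * h)) F a b =
  \sw_(a, b <- Δ g) \sw_(c, d <- Δ h) F (a * c) (b * d).
Proof.
move=> F1 F2; rewrite wh_copM !(tlift_lin _ _ (@tlift_is_lin _ _ _ _ _)).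
apply: eq_tlift => a b; rewrite (tlift_lin _ _ (@tlift_is_lin _ _ _ _ _)).
by apply: eq_tlift => c d; rewrite tlift_pure.
Qed.

Lemma sw_counitl U (F : H -> U) h :
  lin F -> \sw_(a, b <- Δ h) ε a *: F b = F h.
Proof.
move=> hF; transitivity (F (\sw_(a, b <- Δ h) ε a *: b)).
  by rewrite (tlift_lin _ _ hF); apply: eq_tlift => a b; rewrite linZ.
by rewrite wh_counitl.
Qed.

Lemma sw_counitr U (F : H -> U) h :
  lin F -> \sw_(a, b <- Δ h) ε b *: F a = F h.
Proof.
move=> hF; transitivity (F (\sw_(a, b <- Δ h) ε b *: a)).
  by rewrite (tlift_lin _ _ hF); apply: eq_tlift => a b; rewrite linZ.
by rewrite wh_counitr.
Qed.

Lemma sw_cop1l U (F : H -> H -> U) h :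
  (forall y, lin (fun x => F x y)) -> (forall x, lin (fun y => F x y)) ->
  \sw_(a, b <- Δ 1) \sw_(c, d <- Δ h) F (a * c) (b * d) =
  \sw_(a, b <- Δ h) F a b.
Proof. by move=> F1 F2; rewrite -sw_copM // mul1r. Qed.

Lemma sw_cop1r U (F : H -> H -> U) h :
  (forall y, lin (fun x => F x y)) -> (forall x, lin (fun y => F x y)) ->
  \sw_(c, d <- Δ h) \sw_(a, b <- Δ 1) F (c * a) (d * b) =
  \sw_(a, b <- Δ h) F a b.
Proof. by move=> F1 F2; rewrite -sw_copM // mulr1. Qed.

Lemma sw_cop12 U (F : H -> H -> H -> U) :
  (forall y z, lin (fun x => F x y z)) ->
  (forall x z, lin (fun y => F x y z)) ->
  (forall x y, lin (fun z => F x y z)) ->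
  \sw_(a, b <- Δ 1) \sw_(c, d <- Δ b) F a c d =
  \sw_(a, b <- Δ 1) \sw_(c, d <- Δ 1) F a (b * c) d.
Proof.
move=> F1 F2 F3; have := congr1 (tlift (fun x t => tlift (F x) t)) (wh_cop1_12 H).
rewrite !(tlift_lin _ _ (@tlift_is_lin _ _ _ _ _)).
have e (s : H -> H -> tens H H) (x y z : H -> H -> H -> H -> H) :
  \sw_(a, b <- Δ 1) tlift (fun x t => tlift (F x) t)
    (\sw_(c, d <- s a b) x a b c d *t (y a b c d *t z a b c d)) =
  \sw_(a, b <- Δ 1) \sw_(c, d <- s a b) F (x a b c d) (y a b c d) (z a b c d).
  apply: eq_tlift => a b; rewrite (tlift_lin _ _ (@tlift_is_lin _ _ _ _ _)).
  by apply: eq_tlift => c d; rewrite !tlift_pure; lin.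
by rewrite (e (fun a b => Δ b)) (e (fun a b => Δ 1)).
Qed.

Lemma sw_cop21 U (F : H -> H -> H -> U) :
  (forall y z, lin (fun x => F x y z)) ->
  (forall x z, lin (fun y => F x y z)) ->
  (forall x y, lin (fun z => F x y z)) ->
  \sw_(a, b <- Δ 1) \sw_(c, d <- Δ b) F a c d =
  \sw_(a, b <- Δ 1) \sw_(c, d <- Δ 1) F a (c * b) d.
Proof.
move=> F1 F2 F3; have := congr1 (tlift (fun x t => tlift (F x) t)) (wh_cop1_21 H).
rewrite !(tlift_lin _ _ (@tlift_is_lin _ _ _ _ _)).
have e (s : H -> H -> tens H H) (x y z : H -> H -> H -> H -> H) :
  \sw_(a, b <- Δ 1) tlift (fun x t => tlift (F x) t)
    (\sw_(c, d <- s a b) x a b c d *t (y a b c d *t z a b c d)) =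
  \sw_(a, b <- Δ 1) \sw_(c, d <- s a b) F (x a b c d) (y a b c d) (z a b c d).
  apply: eq_tlift => a b; rewrite (tlift_lin _ _ (@tlift_is_lin _ _ _ _ _)).
  by apply: eq_tlift => c d; rewrite !tlift_pure; lin.
by rewrite (e (fun a b => Δ b)) (e (fun a b => Δ 1)).
Qed.

Lemma eps_eps_t g h : ε (g * eps_t h) = ε (g * h).
Proof.
rewrite eps_tE (tlift_lin (g := fun x => ε (g * x))); last by lin.
rewrite -[in RHS](mulr1 g) wh_epsM21; apply: eq_tlift => a b.
by rewrite -scalerAr linearZ /= mulrC.
Qed.

Lemma eps_t_mulr g h : eps_t (g * eps_t h) = eps_t (g * h).
Proof.
by rewrite !eps_tE; apply: eq_tlift => a b; rewrite -eps_tE mulrA eps_eps_t mulrA.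
Qed.

Lemma eps_t_idem h : eps_t (eps_t h) = eps_t h.
Proof. by have := eps_t_mulr 1 h; rewrite !mul1r. Qed.

Lemma eps_t1 : eps_t 1 = 1.
Proof.
by rewrite eps_tE -[RHS](wh_counitl (1 : H)); apply: eq_tlift => a b; rewrite mulr1.
Qed.

Lemma targetP z : reflect (eps_t z = z) (z \in target).
Proof.
apply: (iffP idP) => [/memv_imgP[x _ ->]|<-]; first exact: eps_t_idem.
by rewrite memv_img ?memvf.
Qed.

Lemma eps_t_target h : eps_t h \in target.
Proof. by apply/targetP; apply: eps_t_idem. Qed.

Lemma eps_tM x y : eps_t (x * y) = \sw_(u, v <- Δ x) ε (v * y) *: eps_t u.
Proof.
rewrite eps_tE; under eq_tlift => a b.
  rewrite mulrA wh_epsM12 (tlift_lin (g := fun c : k^o => c *: b)); last by lin.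
  over.
rewrite tliftC; apply: eq_tlift => u v; rewrite eps_tE.
rewrite (tlift_lin (g := fun c => ε (v * y) *: c)); last by lin.
by apply: eq_tlift => a b; rewrite scalerA mulrC.
Qed.

Section Sums.
Variables (U : lmodType k) (F : H -> H -> U).
Hypotheses (F1 : forall y, lin (fun x => F x y))
           (F2 : forall x, lin (fun y => F x y)).

Lemma sw_cop_target z : z \in target ->
  \sw_(a, b <- Δ z) F a b = \sw_(a, b <- Δ 1) F (a * z) b.
Proof.
move/targetP => <-; rewrite eps_tE.
rewrite (tlift_lin (g := fun x => \sw_(a, b <- Δ x) F a b)); last by lin.
under eq_tlift => p q.
  rewrite (linZ (f := fun x => \sw_(a, b <- Δ x) F a b)); last by lin.
  rewrite (tlift_lin (g := fun c => ε (p * z) *: c)); last by lin.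
  over.
rewrite (sw_cop21 (F := fun p a b => ε (p * z) *: F a b)); try by lin.
rewrite tliftC; apply: eq_tlift => c d.
rewrite (tlift_lin (g := fun x => F (c * x) d)); last by lin.
apply: eq_tlift => p q; rewrite (linZ (f := fun x => F (c * x) d)) //; by lin.
Qed.

Lemma sw_eps_tl h :
  \sw_(a, b <- Δ h) F (eps_t a) b = \sw_(a, b <- Δ 1) F (eps_t a) (b * h).
Proof.
rewrite -(sw_cop1l (F := fun a b => F (eps_t a) b)); try by lin.
under eq_tlift => x y.
  under eq_tlift => a b.
    rewrite eps_tM (tlift_lin (g := fun c => F c (y * b))); last by lin.
    under eq_tlift => u v.
      rewrite (linZ (f := fun c => F c (y * b))); last by lin.
      over.
    over.
  rewrite tliftC.
  over.
rewrite (sw_copA (F := fun u v y =>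
  \sw_(a, b <- Δ h) ε (v * a) *: F (eps_t u) (y * b))); try by lin.
apply: eq_tlift => x y.
rewrite -(sw_copM (F := fun p q => ε p *: F (eps_t x) q)); try by lin.
by rewrite (sw_counitl (F := F (eps_t x))).
Qed.

Lemma sw_eps_tr h :
  \sw_(a, b <- Δ h) F a (eps_t b) = \sw_(a, b <- Δ 1) F (a * h) b.
Proof.
rewrite -(sw_cop1l (F := fun a b => F a (eps_t b))); try by lin.
under eq_tlift => x y.
  under eq_tlift => a b.
    rewrite eps_tE (tlift_lin (g := fun c => F (x * a) c)); last by lin.
    under eq_tlift => p q.
      rewrite (linZ (f := fun c => F (x * a) c)); last by lin.
      rewrite mulrA.
      over.
    over.
  rewrite tliftC.
  over.
rewrite -(sw_cop21 (F := fun x m q =>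
  \sw_(a, b <- Δ h) ε (m * b) *: F (x * a) q)); try by lin.
rewrite -(sw_copA (F := fun x m q =>
  \sw_(a, b <- Δ h) ε (m * b) *: F (x * a) q)); try by lin.
apply: eq_tlift => x y.
rewrite -(sw_copM (F := fun p q => ε q *: F p y)); try by lin.
by rewrite (sw_counitr (F := fun p => F p y)).
Qed.
End Sums.

(* eps_bar z = S^-1(eps_t z) *)
Definition eps_bar z := \sw_(a, b <- Δ 1) ε (b * z) *: a.

Lemma sw_mul_eps_bar U (F : H -> H -> U) z :
  (forall y, lin (fun x => F x y)) -> (forall x, lin (fun y => F x y)) ->
  \sw_(a, b <- Δ 1) F (a * eps_bar z) b =
  \sw_(a, b <- Δ 1) F a (eps_t (b * z)).
Proof.
move=> F1 F2; rewrite -sw_eps_tr // /eps_bar.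
rewrite (tlift_lin (g := fun x => \sw_(a, b <- Δ x) F a (eps_t b))); last by lin.
under eq_tlift => p q.
  rewrite (linZ (f := fun x => \sw_(a, b <- Δ x) F a (eps_t b))); last by lin.
  rewrite (tlift_lin (g := fun c => ε (q * z) *: c)); last by lin.
  over.
rewrite (sw_copA (F := fun a b q => ε (q * z) *: F a (eps_t b))); try by lin.
apply: eq_tlift => x y.
rewrite (sw_eps_tl (F := fun a b => ε (b * z) *: F x a)); try by lin.
rewrite -[y * z]mul1r eps_tM (tlift_lin (g := fun c => F x c)); last by lin.
apply: eq_tlift => a b; rewrite (linZ (f := fun c => F x c)); last by lin.
by rewrite mulrA.
Qed.

Lemma sw_cop_mul_target U (F : H -> H -> U) y z :
  (forall y, lin (fun x => F x y)) -> (forall x, lin (fun y => F x y)) ->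
  y \in target -> z \in target ->
  \sw_(a, b <- Δ (z * y)) F a b = \sw_(a, b <- Δ 1) F (a * z * y) b.
Proof.
move=> F1 F2 hy hz; rewrite sw_copM //.
under eq_tlift => a b.
  rewrite (sw_cop_target (F := fun c d => F (a * c) (b * d))) //; try by lin.
  under eq_tlift => c d do rewrite mulrA.
  over.
rewrite (sw_cop1r (F := fun a b => F (a * y) b)); try by lin.
by rewrite (sw_cop_target (F := fun a b => F (a * y) b)) //; lin.
Qed.

Lemma target_mul y z : y \in target -> z \in target -> z * y \in target.
Proof.
move=> hy hz; apply/targetP; rewrite eps_tE -[RHS]wh_counitl.
rewrite (sw_cop_mul_target (F := fun a b => ε a *: b)) //; try by lin.
by apply: eq_tlift => a b; rewrite mulrA.
Qed.

Lemma eps_t_mull g h : eps_t (eps_t g * h) = eps_t g * eps_t h.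
Proof.
by rewrite -eps_t_mulr; apply/targetP; apply: target_mul; apply: eps_t_target.
Qed.

Lemma sw_mul_eps_bar_target U (F : H -> H -> U) z :
  (forall y, lin (fun x => F x y)) -> (forall x, lin (fun y => F x y)) ->
  z \in target ->
  \sw_(a, b <- Δ 1) F (a * eps_bar z) b = \sw_(a, b <- Δ 1) F a (b * z).
Proof.
move=> F1 F2 /targetP hz; rewrite sw_mul_eps_bar //.
transitivity (\sw_(a, b <- Δ 1) F (a * 1) (eps_t (b * z))).
  by apply: eq_tlift => a b; rewrite mulr1.
rewrite -(sw_eps_tr (F := fun a b => F a (eps_t (b * z)))); try by lin.
transitivity (\sw_(a, b <- Δ 1) F (a * 1) (b * z)); last first.
  by apply: eq_tlift => a b; rewrite mulr1.
rewrite -(sw_eps_tr (F := fun a b => F a (b * z))); try by lin.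
by apply: eq_tlift => a b; rewrite eps_t_mull hz.
Qed.

Lemma sw_eps_t_mul h : \sw_(a, b <- Δ h) eps_t a * b = h.
Proof.
under eq_tlift => a b.
  rewrite eps_tE (tlift_lin (g := fun c => c * b)); last by lin.
  under eq_tlift => p q do rewrite -scalerAl.
  over.
rewrite tliftC (sw_cop1l (F := fun p q => ε p *: q)); try by lin.
exact: wh_counitl.
Qed.

Lemma sw_eps_t_mul_target h z : z \in target ->
  \sw_(a, b <- Δ h) eps_t (a * z) * b = h * z.
Proof.
move=> hz; rewrite -[RHS]sw_eps_t_mul.
rewrite (sw_copM (F := fun a b => eps_t a * b)); try by lin.
under [RHS]eq_tlift => a b.
  rewrite (sw_cop_target (F := fun c d => eps_t (a * c) * (b * d))) //;
    try by lin.
  under eq_tlift => c d do rewrite mulrA.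
  over.
by rewrite (sw_cop1r (F := fun a b => eps_t (a * z) * b)) //; lin.
Qed.

Lemma eps_bar_1 : eps_bar 1 = 1.
Proof.
rewrite /eps_bar -[RHS]wh_counitr; apply: eq_tlift => a b; by rewrite mulr1.
Qed.

Lemma sw_eps_bar h z : \sw_(a, b <- Δ h) ε (b * z) *: a = h * eps_bar z.
Proof.
under eq_tlift => a b.
  rewrite -[b in b * z]mulr1 wh_epsM12 (tlift_lin (g := fun c : k^o => c *: a)); last by lin.
  over.
rewrite -(sw_cop1r (F := fun a b =>
  \sw_(p, q <- Δ 1) (ε (b * p) * ε (q * z)) *: a)); try by lin.
under eq_tlift => c d.
  under eq_tlift => x y.
    under eq_tlift => p q do rewrite -mulrA.
    over.
  rewrite -(sw_cop12 (F := fun x m q => (ε (d * m) * ε (q * z)) *: (c * x)));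
    try by lin.
  rewrite -(sw_copA (F := fun x m q => (ε (d * m) * ε (q * z)) *: (c * x)));
    try by lin.
  over.
rewrite tliftC /eps_bar (tlift_lin (g := fun c => h * c)); last by lin.
apply: eq_tlift => x y; rewrite -scalerAr -[h * x]wh_counitr.
rewrite (sw_copM (F := fun a b => ε b *: a)); try by lin.
rewrite (tlift_lin (g := fun c => ε (y * z) *: c)); last by lin.
apply: eq_tlift => a b.
rewrite (tlift_lin (g := fun c => ε (y * z) *: c)); last by lin.
by apply: eq_tlift => c d; rewrite scalerA mulrC.
Qed.

End WeakHopfTheory.

Record rep (k : fieldType) (A : falgType k) := Rep {
  rep_sp :> vectType k;
  ract : A -> rep_sp -> rep_sp;
  ract_linl : forall v, lin (fun a => ract a v);
  ract_linr : forall a, lin (fun v => ract a v);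
  ract1 : forall v, ract 1 v = v;
  ractM : forall a b v, ract (a * b) v = ract a (ract b v) }.

Arguments ract {k A} r a v : rename.
Notation "a ▷ v" := (ract _ a v) (at level 35, right associativity) : ring_scope.

Section RepCategory.
Variables (k : fieldType) (A : falgType k).
Implicit Types M N P : rep A.

Lemma lin_ractr (U : lmodType k) M a (f : U -> M) :
  lin f -> lin (fun x => a ▷ f x).
Proof. by move=> hf; apply: (lin_comp (ract_linr a) hf). Qed.

Lemma lin_ractl (U : lmodType k) M v (f : U -> A) :
  lin f -> lin (fun x => ract M (f x) v).
Proof. by move=> hf; apply: (lin_comp (ract_linl v) hf). Qed.

(* The space of A-linear maps, as the kernel of f |-> (a |-> f a - a f). *)
Definition rhom_space M N : {vspace 'Hom(M, N)} :=
  lker (linfun (fun f : 'Hom(M, N) =>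
    linfun (fun a : A => linfun (fun v : M => f (a ▷ v) - a ▷ f v)))).

End RepCategory.

Ltac lin_step_rep :=
  match goal with
  | |- lin (fun x => ract _ ?a (@?f x)) => apply: (@lin_ractr _ _ _ _ _ f)
  | |- lin (fun x => ract _ (@?f x) ?v) => apply: (@lin_ractl _ _ _ _ _ f)
  | |- lin (ract _ _) => exact: ract_linr
  | |- _ => lin_step
  end.
Ltac lin ::= cbv beta; repeat lin_step_rep.

Section RepCategory2.
Variables (k : fieldType) (A : falgType k).
Implicit Types M N P : rep A.

Lemma lfun0E (V W : vectType k) (v : V) : (0 : 'Hom(V, W)) v = 0.
Proof. by rewrite -(scale0r 0) scale_lfunE scale0r. Qed.

Lemma rhomP M N (f : 'Hom(M, N)) :
  reflect (forall a v, f (a ▷ v) = a ▷ f v) (f \in rhom_space M N).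
Proof.
rewrite memv_ker linfunE_lin; last by lin.
apply: (iffP eqP) => [e a v|e].
  have := congr1 (fun g : 'Hom(A, 'Hom(M, N)) => g a v) e.
  rewrite linfunE_lin; last by lin.
  rewrite linfunE_lin; last by lin.
  by rewrite !lfun0E => /eqP; rewrite subr_eq0 => /eqP.
apply/lfunP => a; apply/lfunP => v.
rewrite linfunE_lin; last by lin.
rewrite linfunE_lin; last by lin.
by rewrite !lfun0E e subrr.
Qed.

Definition rhom M N : vectType k := subvs_of (rhom_space M N).

Definition rhom_fun M N (f : rhom M N) : 'Hom(M, N) := vsval f.

Lemma rhomE M N (f : rhom M N) a v : rhom_fun f (a ▷ v) = a ▷ rhom_fun f v.
Proof. exact/rhomP/subvsP. Qed.

Lemma rhom_funP M N c (f g : rhom M N) v :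
  rhom_fun (c *: f + g) v = c *: rhom_fun f v + rhom_fun g v.
Proof. by rewrite /rhom_fun /= add_lfunE scale_lfunE. Qed.

Definition mk_rhom M N (f : M -> N) : rhom M N := vsproj _ (linfun f).

Lemma mk_rhomE M N (f : M -> N) :
  lin f -> (forall a v, f (a ▷ v) = a ▷ f v) -> rhom_fun (mk_rhom f) =1 f.
Proof.
move=> lf hf v; rewrite /rhom_fun vsprojK ?linfunE_lin //.
by apply/rhomP => a w; rewrite !linfunE_lin.
Qed.

Lemma rhom_inj M N (f g : rhom M N) : rhom_fun f =1 rhom_fun g -> f = g.
Proof. by move=> e; apply/val_inj/lfunP. Qed.

Lemma lin_rhom M N (f : rhom M N) : lin (fun v => rhom_fun f v).
Proof. exact: lin_hom. Qed.

Definition rid M : rhom M M := mk_rhom (fun v => v).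
Definition rcomp M N P (g : rhom N P) (f : rhom M N) : rhom M P :=
  mk_rhom (fun v => rhom_fun g (rhom_fun f v)).

Lemma ridE M v : rhom_fun (rid M) v = v.
Proof. by rewrite mk_rhomE. Qed.

Lemma rcompE M N P (g : rhom N P) (f : rhom M N) v :
  rhom_fun (rcomp g f) v = rhom_fun g (rhom_fun f v).
Proof. by rewrite mk_rhomE => [//||a w]; [lin | rewrite !rhomE]. Qed.

Definition repLin : linCategory k.
Proof.
refine (@LinCategory k (rep A) rhom rid rcomp _ _ _ _ _).
- by move=> M N f; apply: rhom_inj => v; rewrite rcompE ridE.
- by move=> M N f; apply: rhom_inj => v; rewrite rcompE ridE.
- by move=> M N P Q h g f; apply: rhom_inj => v; rewrite !rcompE.
- move=> M N P f c g g'; apply: rhom_inj => v.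
  by rewrite rcompE !rhom_funP !rcompE.
- move=> M N P g c f f'; apply: rhom_inj => v.
  rewrite rcompE !rhom_funP !rcompE.
  exact: lin_rhom.
Defined.

End RepCategory2.

Section RepTensor.
Variables (k : fieldType) (H : weakHopf k).
Local Notation Δ := (wh_cop H).
Local Notation ε := (wh_eps H).
Implicit Types (M N P Q : rep H) (g h z : H).

Definition tact M N (t : tens H H) (x : tens M N) : tens M N :=
  \sw_(a, b <- t) \sw_(v, w <- x) (a ▷ v) *t (b ▷ w).

Lemma tact_linl M N x : lin (fun t => @tact M N t x).
Proof. by rewrite /tact; lin. Qed.

Lemma tact_linr M N t : lin (fun x => @tact M N t x).
Proof. by rewrite /tact; lin. Qed.

Lemma tact_pure M N t (v : M) (w : N) :
  tact t (v *t w) = \sw_(a, b <- t) (a ▷ v) *t (b ▷ w).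
Proof. by apply: eq_tlift => a b; rewrite tlift_pure; lin. Qed.

Lemma tactM M N g h (x : tens M N) :
  tact (Δ (g * h)) x = tact (Δ g) (tact (Δ h) x).
Proof.
move: x; apply: tens_ext.
- exact: tact_linr.
- by apply: (lin_comp (@tact_linr _ _ _)); apply: tact_linr.
move=> v w; rewrite !tact_pure.
rewrite (sw_copM (F := fun a b => (a ▷ v) *t (b ▷ w))); try by lin.
rewrite (tlift_lin _ _ (@tact_linr _ _ _)) tliftC.
apply: eq_tlift => c d; rewrite tact_pure; apply: eq_tlift => a b.
by rewrite !ractM.
Qed.

(* M (x) N is the subspace Delta(1)(M (x)_k N). *)
Definition rten_space M N : {vspace tens M N} :=
  limg (linfun (@tact M N (Δ 1))).

Lemma tact_mem M N h (x : tens M N) : tact (Δ h) x \in rten_space M N.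
Proof.
rewrite -[h]mul1r tactM -[X in X \in _](linfunE_lin (@tact_linr M N (Δ 1))).
by rewrite memv_img ?memvf.
Qed.

Lemma tact1_id M N (x : tens M N) : x \in rten_space M N -> tact (Δ 1) x = x.
Proof.
case/memv_imgP => y _ ->; rewrite linfunE_lin; last exact: tact_linr.
by rewrite -tactM mulr1.
Qed.

Definition rten_sp M N : vectType k := subvs_of (rten_space M N).

Definition rten_inj M N (x : rten_sp M N) : tens M N := vsval x.

Definition rten_proj M N (x : tens M N) : rten_sp M N :=
  vsproj _ (tact (Δ 1) x).

Definition rten_act M N h (x : rten_sp M N) : rten_sp M N :=
  rten_proj (tact (Δ h) (rten_inj x)).

Lemma rten_inj_lin M N : lin (@rten_inj M N).
Proof. exact: lin_vsval. Qed.

Lemma rten_proj_lin M N : lin (@rten_proj M N).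
Proof. by apply: (lin_comp (@lin_vsproj _ _ _)); apply: tact_linr. Qed.

Lemma rten_injK M N (x : rten_sp M N) : rten_proj (rten_inj x) = x.
Proof.
apply: val_inj; rewrite /rten_proj /= vsprojK ?tact_mem //.
by rewrite tact1_id ?subvsP.
Qed.

Lemma rten_projK M N (x : tens M N) : rten_inj (rten_proj x) = tact (Δ 1) x.
Proof. by rewrite /rten_inj /rten_proj vsprojK ?tact_mem. Qed.

Lemma rten_proj_tact M N h (x : tens M N) :
  rten_proj (tact (Δ h) x) = rten_act h (rten_proj x).
Proof.
rewrite /rten_act rten_projK -tactM mulr1 //.
Qed.

Lemma rten_act1 M N (x : rten_sp M N) : rten_act 1 x = x.
Proof. by rewrite -[x]rten_injK -rten_proj_tact /rten_proj -tactM mulr1. Qed.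

Lemma rten_actM M N g h (x : rten_sp M N) :
  rten_act (g * h) x = rten_act g (rten_act h x).
Proof. by rewrite -[x]rten_injK -!rten_proj_tact tactM. Qed.

Lemma rten_act_linl M N (x : rten_sp M N) : lin (fun h => rten_act h x).
Proof.
rewrite /rten_act; apply: (lin_comp (@rten_proj_lin _ _)).
by apply: (lin_comp (@tact_linl _ _ _)); apply: lin_hom.
Qed.

Lemma rten_act_linr M N h : lin (fun x : rten_sp M N => rten_act h x).
Proof.
rewrite /rten_act; apply: (lin_comp (@rten_proj_lin _ _)).
by apply: (lin_comp (@tact_linr _ _ _)); apply: rten_inj_lin.
Qed.

Definition rten M N : rep H :=
  Rep (@rten_act_linl M N) (@rten_act_linr M N)
      (@rten_act1 M N) (@rten_actM M N).

(* The image of v (x) w under the projection Delta(1) onto M (x) N. *)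
Definition rpure M N (v : M) (w : N) : rten M N := rten_proj (v *t w).

Lemma rpure_linl M N (w : N) : lin (fun v : M => rpure v w).
Proof.
by apply: (lin_comp (@rten_proj_lin _ _)); apply: tpure_linl.
Qed.

Lemma rpure_linr M N (v : M) : lin (fun w : N => rpure v w).
Proof.
by apply: (lin_comp (@rten_proj_lin _ _)); apply: tpure_linr.
Qed.

(* Restriction to M (x) N of the linear map v (x) w |-> f v w. *)
Definition rlift M N (U : lmodType k) (f : M -> N -> U) (x : rten M N) : U :=
  \sw_(v, w <- rten_inj x) f v w.

Lemma rlift_lin M N (U : lmodType k) (f : M -> N -> U) : lin (rlift f).
Proof. by apply: (lin_comp (@tlift_is_lin _ _ _ _ _)); apply: rten_inj_lin. Qed.

Lemma rlift_pure M N (U : lmodType k) (f : M -> N -> U) v w :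
  (forall y, lin (fun x => f x y)) -> (forall x, lin (fun y => f x y)) ->
  rlift f (rpure v w) = \sw_(a, b <- Δ 1) f (a ▷ v) (b ▷ w).
Proof.
move=> f1 f2; rewrite /rlift /rpure rten_projK tact_pure.
rewrite (tlift_lin _ _ (@tlift_is_lin _ _ _ _ _)); apply: eq_tlift => a b.
by rewrite tlift_pure.
Qed.

Lemma act_rpure M N h (v : M) (w : N) :
  h ▷ rpure v w = \sw_(a, b <- Δ h) rpure (a ▷ v) (b ▷ w).
Proof.
rewrite /= /rpure -rten_proj_tact tact_pure.
by rewrite (tlift_lin _ _ (@rten_proj_lin _ _)).
Qed.

Lemma rpure1 M N (v : M) (w : N) :
  \sw_(a, b <- Δ 1) rpure (a ▷ v) (b ▷ w) = rpure v w.
Proof. by rewrite -act_rpure ract1. Qed.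

Lemma rten_ext M N (U : lmodType k) (f g : rten M N -> U) :
  lin f -> lin g -> (forall v w, f (rpure v w) = g (rpure v w)) -> f =1 g.
Proof.
move=> hf hg e x; rewrite -[x]rten_injK.
apply: (@tens_ext _ _ _ _ (fun y => f (rten_proj y)) (fun y => g (rten_proj y))).
- exact: (lin_comp hf (@rten_proj_lin _ _)).
- exact: (lin_comp hg (@rten_proj_lin _ _)).
- exact: e.
Qed.

Lemma rten_ext3l M N P (U : lmodType k) (f g : rten (rten M N) P -> U) :
  lin f -> lin g ->
  (forall u v w, f (rpure (rpure u v) w) = g (rpure (rpure u v) w)) -> f =1 g.
Proof.
move=> hf hg e; apply: rten_ext => // x w; move: x.
apply: (rten_ext (f := fun x => f (rpure x w)) (g := fun x => g (rpure x w))).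
- exact: (lin_comp hf (@rpure_linl _ _ _)).
- exact: (lin_comp hg (@rpure_linl _ _ _)).
- by move=> u v; apply: e.
Qed.

Lemma rten_ext3r M N P (U : lmodType k) (f g : rten M (rten N P) -> U) :
  lin f -> lin g ->
  (forall u v w, f (rpure u (rpure v w)) = g (rpure u (rpure v w))) -> f =1 g.
Proof.
move=> hf hg e; apply: rten_ext => // u.
apply: (rten_ext (f := fun x => f (rpure u x)) (g := fun x => g (rpure u x))).
- exact: (lin_comp hf (@rpure_linr _ _ _)).
- exact: (lin_comp hg (@rpure_linr _ _ _)).
- by move=> v w; apply: e.
Qed.

Lemma lin_rpurer (U : lmodType k) M N (v : M) (f : U -> N) :
  lin f -> lin (fun x => rpure v (f x)).
Proof. by move=> hf; apply: (lin_comp (@rpure_linr _ _ _) hf). Qed.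

Lemma lin_rpurel (U : lmodType k) M N (w : N) (f : U -> M) :
  lin f -> lin (fun x => rpure (f x) w).
Proof. by move=> hf; apply: (lin_comp (@rpure_linl _ _ _) hf). Qed.

Lemma lin_rlift (U X : lmodType k) M N (F : M -> N -> X) (f : U -> rten M N) :
  lin f -> lin (fun x => rlift F (f x)).
Proof. by move=> hf; apply: (lin_comp (@rlift_lin _ _ _ _) hf). Qed.

Lemma lin_rliftF (U X : lmodType k) M N (F : U -> M -> N -> X) (t : rten M N) :
  (forall a b, lin (fun x => F x a b)) -> lin (fun x => rlift (F x) t).
Proof. by move=> hF; rewrite /rlift; lin. Qed.

Lemma lin_rhomf (U : lmodType k) M N (g : rhom M N) (f : U -> M) :
  lin f -> lin (fun x => rhom_fun g (f x)).
Proof. by move=> hf; apply: (lin_comp (lin_rhom g) hf). Qed.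

End RepTensor.

Ltac lin_step_ten :=
  match goal with
  | |- lin (fun x => @rpure _ _ _ _ ?v (@?f x)) => apply: (@lin_rpurer _ _ _ _ _ v f)
  | |- lin (fun x => @rpure _ _ _ _ (@?f x) ?v) => apply: (@lin_rpurel _ _ _ _ _ v f)
  | |- lin (@rpure _ _ _ _ _) => exact: rpure_linr
  | |- lin (fun x => @rlift _ _ _ _ _ ?F (@?f x)) => apply: (@lin_rlift _ _ _ _ _ _ F f)
  | |- lin (fun x => @rlift _ _ _ _ _ (@?F x) ?t) => apply: (@lin_rliftF _ _ _ _ _ _ F t)
  | |- lin (@rlift _ _ _ _ _ _) => exact: rlift_lin
  | |- lin (fun x => fun_of_lfun (rhom_fun ?g) (@?f x)) => apply: (@lin_rhomf _ _ _ _ _ g f)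
  | |- _ => lin_step_rep
  end.
Ltac lin ::= cbv beta; repeat lin_step_ten.

Section RepMonoidal.
Variables (k : fieldType) (H : weakHopf k).
Local Notation Δ := (wh_cop H).
Local Notation ε := (wh_eps H).
Implicit Types (M N P Q : rep H) (g h : H).

Definition rtenm M N M' N' (f : rhom M M') (g : rhom N N') :
    rhom (rten M N) (rten M' N') :=
  mk_rhom (rlift (fun v w => rpure (rhom_fun f v) (rhom_fun g w))).

Lemma rtenmE M N M' N' (f : rhom M M') (g : rhom N N') v w :
  rhom_fun (rtenm f g) (rpure v w) = rpure (rhom_fun f v) (rhom_fun g w).
Proof.
have e v' w' : rlift (fun v w => rpure (rhom_fun f v) (rhom_fun g w))
    (rpure v' w') = rpure (rhom_fun f v') (rhom_fun g w').
  rewrite rlift_pure; try by lin.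
  by rewrite -rpure1; apply: eq_tlift => a b; rewrite !rhomE.
rewrite mk_rhomE => [//||h x]; first by lin.
move: x; apply: rten_ext => [||v' w']; try by lin.
rewrite e !act_rpure (tlift_lin _ _ (@rlift_lin _ _ _ _ _ _)).
by apply: eq_tlift => a b; rewrite e !rhomE.
Qed.

Definition rassoc M N P : rhom (rten (rten M N) P) (rten M (rten N P)) :=
  mk_rhom (rlift (fun x w => rlift (fun u v => rpure u (rpure v w)) x)).

Definition rassocV M N P : rhom (rten M (rten N P)) (rten (rten M N) P) :=
  mk_rhom (rlift (fun u x => rlift (fun v w => rpure (rpure u v) w) x)).

Lemma rassocE M N P (u : M) (v : N) (w : P) :
  rhom_fun (rassoc M N P) (rpure (rpure u v) w) = rpure u (rpure v w).
Proof.
pose F := rlift (fun (x : rten M N) (w : P) =>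
  rlift (fun u v => rpure u (rpure v w)) x).
have lF : lin F by rewrite /F; lin.
have e u' v' w' : F (rpure (rpure u' v') w') = rpure u' (rpure v' w').
  rewrite /F rlift_pure; try by lin.
  under eq_tlift => a b.
    rewrite act_rpure (tlift_lin _ _ (@rlift_lin _ _ _ _ _ _)).
    under eq_tlift => c d.
      rewrite rlift_pure; try by lin.
      under eq_tlift => p q do rewrite -!ractM.
      over.
    rewrite tliftC.
    rewrite (sw_cop1l (F := fun c d =>
      rpure (c ▷ u') (rpure (d ▷ v') (b ▷ w')))); try by lin.
    over.
  rewrite (sw_copA (F := fun c d b =>
    rpure (c ▷ u') (rpure (d ▷ v') (b ▷ w')))); try by lin.
  rewrite -[RHS]rpure1; apply: eq_tlift => a b.
  rewrite act_rpure (tlift_lin (g := fun y => rpure (a ▷ u') y)) //; by lin.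
rewrite mk_rhomE => [//||h x]; first exact: lF.
rewrite -/F; move: x; apply: rten_ext3l => [||u' v' w']; try by lin.
rewrite e !act_rpure (tlift_lin _ _ lF).
under eq_tlift => a b.
  rewrite act_rpure (tlift_lin (g := fun y => F (rpure y (b ▷ w')))); last by lin.
  under eq_tlift => c d do rewrite e.
  over.
rewrite (sw_copA (F := fun c d b =>
  rpure (c ▷ u') (rpure (d ▷ v') (b ▷ w')))); try by lin.
apply: eq_tlift => a b.
by rewrite act_rpure (tlift_lin (g := fun y => rpure (a ▷ u') y)) //; lin.
Qed.

Lemma rassocVE M N P (u : M) (v : N) (w : P) :
  rhom_fun (rassocV M N P) (rpure u (rpure v w)) = rpure (rpure u v) w.
Proof.
pose F := rlift (fun (u : M) (x : rten N P) =>
  rlift (fun v w => rpure (rpure u v) w) x).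
have lF : lin F by rewrite /F; lin.
have e u' v' w' : F (rpure u' (rpure v' w')) = rpure (rpure u' v') w'.
  rewrite /F rlift_pure; try by lin.
  under eq_tlift => a b.
    rewrite act_rpure (tlift_lin _ _ (@rlift_lin _ _ _ _ _ _)).
    under eq_tlift => c d.
      rewrite rlift_pure; try by lin.
      under eq_tlift => p q do rewrite -!ractM.
      over.
    rewrite tliftC.
    rewrite (sw_cop1l (F := fun c d =>
      rpure (rpure (a ▷ u') (c ▷ v')) (d ▷ w'))); try by lin.
    over.
  rewrite -(sw_copA (F := fun a c d =>
    rpure (rpure (a ▷ u') (c ▷ v')) (d ▷ w'))); try by lin.
  rewrite -[RHS]rpure1; apply: eq_tlift => a b.
  rewrite act_rpure (tlift_lin (g := fun y => rpure y (b ▷ w'))) //; by lin.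
rewrite mk_rhomE => [//||h x]; first exact: lF.
rewrite -/F; move: x; apply: rten_ext3r => [||u' v' w']; try by lin.
rewrite e !act_rpure (tlift_lin _ _ lF).
under eq_tlift => a b.
  rewrite act_rpure (tlift_lin (g := fun y => F (rpure (a ▷ u') y))); last by lin.
  under eq_tlift => c d do rewrite e.
  over.
rewrite -(sw_copA (F := fun a c d =>
  rpure (rpure (a ▷ u') (c ▷ v')) (d ▷ w'))); try by lin.
apply: eq_tlift => a b.
by rewrite act_rpure (tlift_lin (g := fun y => rpure y (b ▷ w'))) //; lin.
Qed.

(* The unit object H_t, with action h . z = eps_t (h z). *)
Definition unit_act h (z : subvs_of (target H)) : subvs_of (target H) :=
  vsproj _ (eps_t H (h * vsval z)).

Lemma unit_actE h (z : subvs_of (target H)) :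
  vsval (unit_act h z) = eps_t H (h * vsval z).
Proof. by rewrite /unit_act vsprojK // eps_t_target. Qed.

Lemma unit_act_linl z : lin (fun h => unit_act h z).
Proof. by rewrite /unit_act; lin. Qed.

Lemma unit_act_linr h : lin (fun z => unit_act h z).
Proof. by rewrite /unit_act; lin. Qed.

Lemma unit_act1 z : unit_act 1 z = z.
Proof. by apply: val_inj; rewrite /= unit_actE mul1r; apply/targetP/subvsP. Qed.

Lemma unit_actM g h z : unit_act (g * h) z = unit_act g (unit_act h z).
Proof. by apply: val_inj; rewrite /= !unit_actE eps_t_mulr mulrA. Qed.

Definition runit_rep : rep H :=
  Rep unit_act_linl unit_act_linr unit_act1 unit_actM.

Definition unit_val (z : runit_rep) : H := vsval z.

Lemma unit_val_target z : unit_val z \in target H.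
Proof. exact: subvsP. Qed.

Lemma unit_val_lin : lin unit_val.
Proof. exact: lin_vsval. Qed.

Lemma unit_val_act h z : unit_val (h ▷ z) = eps_t H (h * unit_val z).
Proof. exact: unit_actE. Qed.

Definition unit_one : runit_rep := vsproj _ 1.

Lemma unit_val1 : unit_val unit_one = 1.
Proof. by rewrite /unit_val vsprojK // -eps_t1 eps_t_target. Qed.

(* The unitors are the restrictions of eps (x) id and id (x) eps; on z (x) v
   and v (x) z (projected to the truncated tensor product) they give z . v and
   S^-1(z) . v, and the latter is S(z) . v when H is regular. *)
Definition rlunit M : rhom (rten runit_rep M) M :=
  mk_rhom (rlift (fun (z : runit_rep) v => ε (unit_val z) *: v)).
Definition rlunitV M : rhom M (rten runit_rep M) :=
  mk_rhom (fun v => rpure unit_one v).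
Definition rrunit M : rhom (rten M runit_rep) M :=
  mk_rhom (rlift (fun v (z : runit_rep) => ε (unit_val z) *: v)).
Definition rrunitV M : rhom M (rten M runit_rep) :=
  mk_rhom (fun v => rpure v unit_one).

Lemma rlunitE M (z : runit_rep) (v : M) :
  rhom_fun (rlunit M) (rpure z v) = unit_val z ▷ v.
Proof.
pose F := rlift (fun (z : runit_rep) (v : M) => ε (unit_val z) *: v).
have lF : lin F by rewrite /F; lin; apply: unit_val_lin.
have e z' v' : F (rpure z' v') = unit_val z' ▷ v'.
  rewrite /F rlift_pure; [|by lin; apply: unit_val_lin|by lin].
  have /targetP hz := unit_val_target z'.
  rewrite -[in RHS]hz eps_tE (tlift_lin (g := fun y => y ▷ v')); last by lin.
  apply: eq_tlift => a b; rewrite unit_val_act -[eps_t H _]mul1r eps_eps_t mul1r.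
  by rewrite (linZ (f := fun y => y ▷ v')) //; lin.
rewrite mk_rhomE => [//||h x]; first exact: lF.
rewrite -/F; move: x; apply: rten_ext => [||z' v']; try by lin.
rewrite act_rpure (tlift_lin _ _ lF) e -ractM.
rewrite -(sw_eps_t_mul_target h (unit_val_target z')).
rewrite (tlift_lin (g := fun y => y ▷ v')); last by lin.
by apply: eq_tlift => a b; rewrite e unit_val_act ractM.
Qed.

Definition tproj (h : H) : runit_rep := vsproj (target H) h.

Lemma tproj_lin : lin tproj.
Proof. exact: lin_vsproj. Qed.

Lemma act_unitE h (z : runit_rep) : h ▷ z = tproj (eps_t H (h * unit_val z)).
Proof. by []. Qed.

Lemma act_one h : h ▷ unit_one = tproj (eps_t H h).
Proof. by rewrite act_unitE unit_val1 mulr1. Qed.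

Lemma lin_rpure_tproj1 M (v : M) (y : H) :
  lin (fun a => rpure (tproj a) (y ▷ v)).
Proof. by lin; apply: tproj_lin. Qed.

Lemma lin_rpure_tproj2 M (v : M) (y : H) :
  lin (fun a => rpure (y ▷ v) (tproj a)).
Proof. by lin; apply: tproj_lin. Qed.

Lemma rlunitVE M (v : M) : rhom_fun (rlunitV M) v = rpure unit_one v.
Proof.
rewrite mk_rhomE => [//||h w]; first by lin.
rewrite -[LHS]rpure1 act_rpure.
under eq_tlift => a b do rewrite act_one -ractM.
under [RHS]eq_tlift => a b do rewrite act_one.
rewrite (sw_eps_tl (F := fun a b => rpure (tproj a) (b ▷ w))) //.
  exact: lin_rpure_tproj1.
by lin.
Qed.

Lemma rpure_one_l M (z : runit_rep) (v : M) :
  rpure unit_one (unit_val z ▷ v) = rpure z v.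
Proof.
pose F a b := rpure (tproj a) (b ▷ v).
have F1 y : lin (fun x => F x y) by apply: lin_rpure_tproj1.
have F2 x : lin (fun y => F x y) by rewrite /F; lin.
rewrite -[LHS]rpure1.
under eq_tlift => a b do rewrite act_one -ractM -/(F _ _).
rewrite -(sw_eps_tl F1 F2) (sw_cop_target (F := fun a b => F (eps_t H a) b)).
- by rewrite -[RHS]rpure1; apply: eq_tlift => a b; rewrite act_unitE.
- by move=> y; apply: (lin_comp (F1 y)); apply: lin_hom.
- by move=> y; apply: F2.
- exact: unit_val_target.
Qed.

Lemma rrunitE M (v : M) (z : runit_rep) :
  rhom_fun (rrunit M) (rpure v z) = eps_bar (unit_val z) ▷ v.
Proof.
pose F := rlift (fun (v : M) (z : runit_rep) => ε (unit_val z) *: v).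
have lF : lin F by rewrite /F; lin.
have e v' z' : F (rpure v' z') = eps_bar (unit_val z') ▷ v'.
  rewrite /F rlift_pure; [|by lin|by lin; apply: unit_val_lin].
  rewrite /eps_bar (tlift_lin (g := fun y => y ▷ v')); last by lin.
  apply: eq_tlift => a b; rewrite unit_val_act -[eps_t H _]mul1r eps_eps_t mul1r.
  by rewrite (linZ (f := fun y => y ▷ v')) //; lin.
rewrite mk_rhomE => [//||h x]; first exact: lF.
rewrite -/F; move: x; apply: rten_ext => [||v' z']; try by lin.
rewrite act_rpure (tlift_lin _ _ lF) e -ractM -sw_eps_bar.
rewrite -(sw_cop1l (F := fun a b => ε (b * unit_val z') *: a)); try by lin.
rewrite (tlift_lin (g := fun y => y ▷ v')); last by lin.
under [RHS]eq_tlift => x y.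
  rewrite (tlift_lin (g := fun y => y ▷ v')); last by lin.
  over.
rewrite tliftC; apply: eq_tlift => a b.
rewrite e unit_val_act /eps_bar (tlift_lin (g := fun y => y ▷ (a ▷ v')));
  last by lin.
apply: eq_tlift => x y; rewrite eps_eps_t mulrA.
rewrite (linZ (f := fun y => y ▷ (a ▷ v'))); last by lin.
by rewrite (linZ (f := fun y => y ▷ v')) ?ractM //; lin.
Qed.

Lemma rrunitVE M (v : M) : rhom_fun (rrunitV M) v = rpure v unit_one.
Proof.
rewrite mk_rhomE => [//||h w]; first by lin.
pose F a b := rpure (a ▷ w) (tproj b).
have F1 y : lin (fun x => F x y) by rewrite /F; lin.
have F2 x : lin (fun y => F x y) by apply: lin_rpure_tproj2.
rewrite -[LHS]rpure1 act_rpure.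
under eq_tlift => a b do rewrite act_one -ractM -/(F _ _).
under [RHS]eq_tlift => a b do rewrite act_one -/(F _ _).
rewrite (sw_eps_tr F1 F2) (sw_eps_tr (F := fun a b => F (a * h) b)).
- by apply: eq_tlift => a b; rewrite mulr1.
- by move=> y; apply: (lin_comp (F1 y)); apply: lin_mull.
- by move=> y; apply: F2.
Qed.

Lemma rpure_one_r M (v : M) (z : runit_rep) :
  rpure (eps_bar (unit_val z) ▷ v) unit_one = rpure v z.
Proof.
pose F a b := rpure (a ▷ v) (tproj b).
have F1 y : lin (fun x => F x y) by rewrite /F; lin.
have F2 x : lin (fun y => F x y) by apply: lin_rpure_tproj2.
rewrite -rrunitVE rhomE rrunitVE act_rpure.
under eq_tlift => a b do rewrite act_one -/(F _ _).
rewrite (sw_eps_tr F1 F2) (sw_mul_eps_bar _ F1 F2) -[RHS]rpure1.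
by apply: eq_tlift => a b; rewrite act_unitE.
Qed.

Lemma rtriangle M N (v : M) (z : runit_rep) (w : N) :
  rpure v (unit_val z ▷ w) = rpure (eps_bar (unit_val z) ▷ v) w.
Proof.
rewrite -[LHS]rpure1 -[RHS]rpure1.
under [RHS]eq_tlift => a b do rewrite -ractM.
rewrite (sw_mul_eps_bar_target (F := fun a b => rpure (a ▷ v) (b ▷ w))).
- by apply: eq_tlift => a b; rewrite ractM.
- by lin.
- by lin.
- exact: unit_val_target.
Qed.

Definition repMonoidal : monoidal (repLin H).
Proof.
refine (@Monoidal (repLin H) runit_rep (@rten k H) rtenm rassoc rassocV
  rlunit rlunitV rrunit rrunitV _ _ _ _ _ _ _ _ _ _).
- move=> M N; apply: rhom_inj; apply: rten_ext => [||v w]; try by lin.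
  by rewrite rtenmE !ridE.
- move=> M N M' N' M'' N'' f' f g' g.
  apply: rhom_inj; apply: rten_ext => [||v w]; try by lin.
  by rewrite rtenmE !rcompE !rtenmE.
- move=> M N P; split; apply: rhom_inj.
    apply: rten_ext3l => [||u v w]; try by lin.
    by rewrite rcompE rassocE rassocVE ridE.
  apply: rten_ext3r => [||u v w]; try by lin.
  by rewrite rcompE rassocVE rassocE ridE.
- move=> M; split; apply: rhom_inj.
    apply: rten_ext => [||z v]; try by lin.
    by rewrite rcompE rlunitE rlunitVE ridE rpure_one_l.
  by move=> v; rewrite rcompE rlunitVE rlunitE ridE unit_val1 ract1.
- move=> M; split; apply: rhom_inj.
    apply: rten_ext => [||v z]; try by lin.
    by rewrite rcompE rrunitE rrunitVE ridE rpure_one_r.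
  by move=> v; rewrite rcompE rrunitVE rrunitE ridE unit_val1 eps_bar_1 ract1.
- move=> M N P M' N' P' f g h; apply: rhom_inj.
  apply: rten_ext3l => [||u v w]; try by lin.
  by rewrite !rcompE !(rtenmE, rassocE).
- move=> M M' f; apply: rhom_inj; apply: rten_ext => [||z v]; try by lin.
  by rewrite !rcompE rtenmE !rlunitE ridE rhomE.
- move=> M M' f; apply: rhom_inj; apply: rten_ext => [||v z]; try by lin.
  by rewrite !rcompE rtenmE !rrunitE ridE rhomE.
- move=> M N P Q; apply: rhom_inj; apply: rten_ext => [||x q]; try by lin.
  move: x; apply: (rten_ext3l (f := fun x => rhom_fun _ (rpure x q))
                              (g := fun x => rhom_fun _ (rpure x q)))
    => [||u v w]; try by lin.
  by rewrite !rcompE !(rtenmE, rassocE, ridE).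
- move=> M N; apply: rhom_inj; apply: rten_ext3l => [||v z w]; try by lin.
  by rewrite !rcompE rassocE !rtenmE rlunitE rrunitE !ridE rtriangle.
Defined.

Definition RepH : linMonCategory k := LinMonCategory repMonoidal.

Definition left_ideal (I : {vspace H}) :=
  forall a x, x \in I -> a * x \in I.

(* H is semisimple as a left module over itself. *)
Definition wh_semisimple :=
  forall I, left_ideal I ->
    exists2 J, left_ideal J & (I + J = fullv)%VS /\ (I :&: J = 0)%VS.

Definition wh_regular :=
  forall x, x \in agenv (target H + source H) -> wh_S H (wh_S H x) = x.

Definition wh_connected := (target H :&: 'Z({: H}))%VS = 1%VS.

End RepMonoidal.

(* Main.v *)
Require Import Defs.
From HB Require Import structures.
From mathcomp Require Import all_boot all_order all_algebra all_field.
From mathcomp Require Import boolp.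

(** The unit object 1 of Rep(H) is the target subalgebra H_t.  Its endomorphisms
    are the multiplications by elements of H_t that are central in H
    ([unit_end_central], [unit_end_of_central]), so H is connected exactly when
    every endomorphism of 1 is a scalar ([connectedP]).

    If H is connected then 1 is simple: the projection of 1 onto a proper
    subrepresentation along a complementary one is a scalar, hence zero.  For a
    nonzero algebra A the unit morphism u : 1 -> A is nonzero, hence injective,
    hence has a retraction p by complete reducibility.  Then
      h : M (x) A -> N (x) A   |->   (N (x) p) h (M (x) u) : M -> N
    (up to the unitors) is natural and sends f (x) A to f, so - (x) A is
    separable ([split_one_separable]).

    If H is not connected, a nonscalar endomorphism of 1 has an eigenvalue, and
    the corresponding eigenspace is a proper nonzero subrepresentation of 1; by
    complete reducibility it is the image of an idempotent e of End(1).  This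
    image A is an ideal of H_t and an algebra with unit e ([ideal_algebra]), and
    (1 - e) (x) A = 0 ([ideal_complement_kills]).  A separable functor is
    faithful ([separable_faithful]), so separability of - (x) A would force
    e = 1, which contradicts that A is proper.

    The complete reducibility of all representations ([stable_complement]) is
    derived from the fact that left ideals of H have complements. *)

Set Implicit Arguments.
Unset Strict Implicit.
Unset Printing Implicit Defensive.

Import GRing.Theory VectorInternalTheory.
Local Open Scope ring_scope.
Local Open Scope cat_scope.

(** * Separability of the free module functor *)

Section SeparableFree.
Variables (E : monCategory) (A : algebra E).

Lemma runitV_nat (X Y : E) (f : mor X Y) :
  (f ⊠ idm (un E)) ∘ runitV X = runitV Y ∘ f.
Proof.
by rewrite -[LHS]cmp1m -(runitK Y) -cmpA (cmpA _ _ (runitV X)) runit_nat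
  -(cmpA f) runitVK cmpm1.
Qed.

(** This is separability of a left adjoint whose unit M -> M (x) A splits
    naturally, here by M (x) p. *)
Lemma split_one_separable (p : mor (A : E) (un E)) :
  p ∘ alg_one A = idm (un E) -> separable_functor (free_functor A).
Proof.
move=> pu.
exists (fun X Y (h : rmodule_mor (free_rmodule A X) (free_rmodule A Y)) =>
          runit Y ∘ (idm Y ⊠ p) ∘ rmm_mor h ∘ (idm X ⊠ alg_one A) ∘ runitV X).
split=> [X Y X' Y' u v h|X Y f] /=.
- have eu : (u ⊠ idm (A : E)) ∘ (idm X' ⊠ alg_one A) ∘ runitV X' =
            (idm X ⊠ alg_one A) ∘ runitV X ∘ u.
    by rewrite -[RHS]cmpA -runitV_nat cmpA -!tenmM !cmpm1 !cmp1m.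
  have ev : runit Y' ∘ (idm Y' ⊠ p) ∘ (v ⊠ idm (A : E)) =
            v ∘ (runit Y ∘ (idm Y ⊠ p)).
    by rewrite -[LHS]cmpA [RHS]cmpA -runit_nat -[RHS]cmpA -!tenmM
      !cmpm1 !cmp1m.
  rewrite !cmpA ev -!cmpA; congr (_ ∘ _); congr (_ ∘ _); congr (_ ∘ _).
  by congr (_ ∘ _); rewrite cmpA eu cmpA.
- rewrite -!cmpA (cmpA _ (f ⊠ _)) -tenmM cmp1m cmpm1.
  rewrite (cmpA _ (idm X ⊠ _)) -tenmM cmpm1 pu.
  by rewrite cmpA runit_nat -cmpA runitVK cmpm1.
Qed.

Lemma separable_faithful (X Y : E) (f g : mor X Y) :
  separable_functor (free_functor A) ->
  f ⊠ idm (A : E) = g ⊠ idm (A : E) -> f = g.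
Proof.
case=> P [_ PK] e; rewrite -[f]PK -[g]PK; congr (P _ _ _).
exact: rmodule_morP.
Qed.

End SeparableFree.

(** * Complete reducibility of representations *)

Section ZeroLemmas.
Variables (k : fieldType) (A : falgType k).
Implicit Types M N : rep A.

Lemma ract0r M a : a ▷ (0 : M) = 0.
Proof. by rewrite -[X in _ ▷ X](scale0r 0) linZ ?scale0r //; lin. Qed.

Lemma ract0l M (v : M) : 0 ▷ v = 0.
Proof.
rewrite -[X in ract _ X _](scale0r 0) (linZ (f := fun a => a ▷ v)) ?scale0r //.
by lin.
Qed.

Lemma ract_addl M a b (v : M) : (a + b) ▷ v = a ▷ v + b ▷ v.
Proof. by rewrite -[a in LHS]scale1r ract_linl scale1r. Qed.

Lemma ract_addr M a (v w : M) : a ▷ (v + w) = a ▷ v + a ▷ w.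
Proof. by rewrite -[v in LHS]scale1r ract_linr scale1r. Qed.

Lemma rhom0E M N (v : M) : rhom_fun (0 : rhom M N) v = 0.
Proof. exact: lfun0E. Qed.

Lemma rhom_subE M N (f g : rhom M N) v :
  rhom_fun (f - g) v = rhom_fun f v - rhom_fun g v.
Proof. by rewrite addrC -scaleN1r rhom_funP scaleN1r addrC. Qed.

End ZeroLemmas.

Section Subrepresentations.
Variables (k : fieldType) (H : weakHopf k).
Implicit Types M N : rep H.

Definition stable M (V : {vspace M}) := forall h v, v \in V -> h ▷ v \in V.

Lemma stable_lker M N (f : rhom M N) : stable (lker (rhom_fun f)).
Proof.
by move=> h v; rewrite !memv_ker rhomE => /eqP ->; rewrite ract0r.
Qed.

Lemma stable_limg M N (f : rhom M N) : stable (limg (rhom_fun f)).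
Proof. by move=> h _ /memv_imgP[v _ ->]; rewrite -rhomE memv_img ?memvf. Qed.

Lemma stable_add M (V W : {vspace M}) :
  stable V -> stable W -> stable (V + W)%VS.
Proof.
move=> hV hW h _ /memv_addP[v Vv [w Ww ->]].
by rewrite ract_addr memv_add ?hV ?hW.
Qed.

Hypothesis Hss : wh_semisimple H.

(** Take m outside V + W and a left ideal J complementary to the left ideal
    I = {h | h m in V + W}.  Then J m meets V + W trivially because J meets I
    trivially, and J m is not inside W because m itself lies in I m + J m. *)
Lemma larger_disjoint M (V W : {vspace M}) :
  stable V -> stable W -> (V :&: W = 0)%VS -> (V + W != fullv)%VS ->
  exists W' : {vspace M},
    [/\ stable W', (V :&: W' = 0)%VS & (\dim W < \dim W')%N].
Proof.
move=> hV hW VW0 /negP VWn.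
have [m mn] : exists m, m \notin (V + W)%VS.
  have /subvPn[m _ mn] : ~~ (fullv <= V + W)%VS.
    by apply/negP => h; apply: VWn; rewrite eqEsubv subvf.
  by exists m.
have hVW := stable_add hV hW.
pose I := (linfun (fun h : H => h ▷ m) @^-1: (V + W))%VS.
have IP h : (h \in I) = (h ▷ m \in (V + W)%VS).
  by rewrite -memv_preim linfunE_lin //; lin.
have [a x|J hJ [IJ1 IJ0]] := Hss (I := I).
  by rewrite !IP ractM; apply: hVW.
pose Jm := (linfun (fun h : H => h ▷ m) @: J)%VS.
have JmP v : v \in Jm -> exists2 j, j \in J & v = j ▷ m.
  by case/memv_imgP => j Jj ->; exists j => //; rewrite linfunE_lin //; lin.
have memJm j : j \in J -> j ▷ m \in Jm.
  move=> Jj; rewrite -[_ ▷ _](linfunE_lin (f := fun h : H => h ▷ m)).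
    by rewrite memv_img.
  by lin.
have Jm0 v : v \in Jm -> v \in (V + W)%VS -> v = 0.
  move=> /JmP[j Jj ->]; rewrite -IP => Ij.
  have : j \in (I :&: J)%VS by rewrite memv_cap Ij.
  by rewrite IJ0 memv0 => /eqP ->; rewrite ract0l.
exists (W + Jm)%VS; split.
- apply: stable_add => // h _ /JmP[j Jj ->].
  by rewrite -ractM memJm ?hJ.
- apply/eqP; rewrite -subv0; apply/subvP => v; rewrite memv_cap.
  case/andP => Vv /memv_addP[w Ww [u Ju ve]].
  have u0 : u = 0.
    apply: Jm0 => //; rewrite -(addKr w u) -ve addrC.
    by rewrite memv_add // memvN.
  by move: ve; rewrite u0 addr0 => ve; rewrite -VW0 memv_cap Vv ve.
- rewrite (ltn_leqif (dimv_leqif_eq (addvSl W Jm))).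
  apply/negP => /eqP We; move/negP: mn; apply.
  have /memv_addP[i Ii [j Jj e1]] : (1 : H) \in (I + J)%VS by rewrite IJ1 memvf.
  rewrite -[m]ract1 e1 ract_addl.
  apply: rpredD; first by rewrite -IP.
  apply: (subvP (addvSr V W)); rewrite We; apply: (subvP (addvSr W Jm)).
  exact: memJm.
Qed.

(** A stable subspace of maximal dimension among those disjoint from V is a
    complement of V, by the previous lemma. *)
Lemma stable_complement M (V : {vspace M}) : stable V ->
  exists W : {vspace M},
    [/\ stable W, (V + W = fullv)%VS & (V :&: W = 0)%VS].
Proof.
move=> hV.
suff extend n (W : {vspace M}) : stable W -> (V :&: W = 0)%VS ->
    (\dim {:M} - \dim W <= n)%N ->
    exists W' : {vspace M},
      [/\ stable W', (V + W' = fullv)%VS &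
      (V :&: W' = 0)%VS].
  apply: (extend _ 0%VS _ (capv0 V) (leqnn _)) => h v.
  by rewrite !memv0 => /eqP ->; rewrite ract0r.
elim: n W => [|n IHn] W hW VW0 dW;
  have [VW1|VWn] := eqVneq (V + W)%VS fullv; try by exists W.
- have [W' [_ _]] := larger_disjoint hV hW VW0 VWn.
  rewrite ltnNge => /negP[]; move: dW; rewrite leqn0 subn_eq0.
  by apply: leq_trans; rewrite dimvS ?subvf.
- have [W' [hW' VW0' dW']] := larger_disjoint hV hW VW0 VWn.
  apply: (IHn W') => //; rewrite -ltnS; apply: leq_trans dW.
  by apply: ltn_sub2l => //; apply: (leq_trans dW'); rewrite dimvS ?subvf.
Qed.

Lemma stable_proj M (V : {vspace M}) : stable V ->
  exists p : rhom M M,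
    (forall m, rhom_fun p m \in V) /\ {in V, rhom_fun p =1 id}.
Proof.
move=> hV; have [W [hW VW1 VW0]] := stable_complement hV.
pose p := mk_rhom (fun m => daddv_pi V W m).
have pE m : rhom_fun p m = daddv_pi V W m.
  rewrite mk_rhomE => [//||h v]; first exact: lin_hom.
  have WV0 : (W :&: V = 0)%VS by rewrite capvC.
  have e (u : M) : daddv_pi V W u + daddv_pi W V u = u.
    by rewrite daddv_pi_add // VW1 memvf.
  rewrite -{1}[v]e ract_addr linearD /=.
  rewrite daddv_pi_id //; last by apply: hV; apply: memv_pi.
  set w := daddv_pi W V v; have Ww : h ▷ w \in W by apply: hW; apply: memv_pi.
  have := e (h ▷ w); rewrite (daddv_pi_id WV0 Ww) => /(canRL (addrK _)).
  by rewrite subrr => ->; rewrite addr0.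
exists p; split=> [m|v Vv]; rewrite pE ?memv_pi //.
exact: daddv_pi_id.
Qed.

Lemma rhom_retraction M N (f : rhom M N) : lker (rhom_fun f) = 0%VS ->
  exists g : rhom N M, rcomp g f = rid M.
Proof.
move=> f0; have [p [pV pid]] := stable_proj (@stable_limg _ _ f).
have fK : cancel (rhom_fun f) (rhom_fun f)^-1%VF.
  by apply: lker0_lfunK; rewrite f0.
pose g := mk_rhom (fun n => (rhom_fun f)^-1%VF (rhom_fun p n)).
have gE n : rhom_fun g n = (rhom_fun f)^-1%VF (rhom_fun p n).
  rewrite mk_rhomE => [//||h v].
    by apply: (lin_comp (lin_hom _)); apply: lin_rhom.
  apply: (can_inj fK); rewrite rhomE [in RHS]rhomE !limg_lfunVK ?pV //.
  by apply: stable_limg; apply: pV.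
exists g; apply: rhom_inj => v; rewrite rcompE gE pid ?ridE ?fK //.
by rewrite memv_img ?memvf.
Qed.

Section Subrep.
Variables (M : rep H) (V : {vspace M}) (hV : stable V).

Definition subrep_act h (v : subvs_of V) : subvs_of V := vsproj V (h ▷ vsval v).

Lemma subrep_actE h v : vsval (subrep_act h v) = h ▷ vsval v.
Proof. by rewrite /subrep_act vsprojK // hV ?subvsP. Qed.

Fact subrep_act_linl v : lin (fun h => subrep_act h v).
Proof. by rewrite /subrep_act; lin. Qed.

Fact subrep_act_linr h : lin (fun v => subrep_act h v).
Proof. by rewrite /subrep_act; lin. Qed.

Fact subrep_act1 v : subrep_act 1 v = v.
Proof. by apply: val_inj; rewrite /= subrep_actE ract1. Qed.

Fact subrep_actM g h v : subrep_act (g * h) v = subrep_act g (subrep_act h v).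
Proof. by apply: val_inj; rewrite /= !subrep_actE ractM. Qed.

Definition subrep : rep H :=
  Rep subrep_act_linl subrep_act_linr subrep_act1 subrep_actM.

Definition sub_val (v : subrep) : M := vsval v.

Lemma sub_val_inj : injective sub_val.
Proof. exact: val_inj. Qed.

Lemma sub_val_mem v : sub_val v \in V.
Proof. exact: subvsP. Qed.

Lemma sub_val_act h v : sub_val (h ▷ v) = h ▷ sub_val v.
Proof. exact: subrep_actE. Qed.

Definition sub_proj (m : M) : subrep := vsproj V m.

Lemma sub_projK m : m \in V -> sub_val (sub_proj m) = m.
Proof. exact: vsprojK. Qed.

Lemma sub_proj_lin : lin sub_proj.
Proof. exact: lin_vsproj. Qed.

End Subrep.

End Subrepresentations.

(** * The endomorphisms of the unit object *)

Lemma eigenvector (k : closedFieldType) (V : vectType k) (f : 'End(V)) (v : V) :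
  v != 0 -> exists a w, w != 0 /\ f w = a *: w.
Proof.
move=> v0; pose F u := v2r (f (r2v u)).
have lF : linear F by move=> c x y; rewrite /F !linearP.
pose Fl : {linear _ -> _} := HB.pack F (GRing.isLinear.Build k _ _ *:%R F lF).
pose A := lin1_mx Fl.
have n0 : (0 < dim V)%N.
  rewrite lt0n; apply: contra_neq v0 => d0; rewrite -[v]v2rK.
  suff -> : v2r v = 0 by rewrite linear0.
  by apply/rowP => -[j jd]; exfalso; move: jd; rewrite d0.
have /closed_rootP[a] : size (char_poly A) != 1%N.
  by rewrite size_char_poly eqSS -lt0n.
rewrite -eigenvalue_root_char => /eigenvalueP[u uA u0].
exists a, (r2v u); split; first by rewrite -(linear0 r2v) (can_eq r2vK).
apply: (can_inj v2rK); by rewrite linearZ /= r2vK -uA mul_rV_lin1.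
Qed.

Section UnitObject.
Variables (k : fieldType) (H : weakHopf k).
Implicit Types (z w : runit_rep H) (f : rhom (runit_rep H) (runit_rep H)).
Local Notation "'u1'" := (unit_one H).

Lemma unit_val_inj : injective (@unit_val k H).
Proof. exact: val_inj. Qed.

Lemma unit_val_actM z w : unit_val (unit_val z ▷ w) = unit_val z * unit_val w.
Proof.
by rewrite unit_val_act; apply/targetP/target_mul; apply: unit_val_target.
Qed.

(** The elements of the source subalgebra act on H_t by right multiplications:
    eps_bar is an algebra antiisomorphism of H_t onto H_s.  The formula is
    the image of eps_bar(z) w (x) 1 = w (x) z under the left unitor of H_t. *)
Lemma unit_val_eps_bar z w :
  unit_val (eps_bar (unit_val z) ▷ w) = unit_val w * unit_val z.
Proof.
have := congr1 (rhom_fun (rlunit (runit_rep H))) (rpure_one_r w z).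
rewrite !rlunitE => /(congr1 (@unit_val k H)).
by rewrite !unit_val_actM unit_val1 mulr1.
Qed.

Lemma act_unit_one z : unit_val z ▷ u1 = z.
Proof. by apply: unit_val_inj; rewrite unit_val_actM unit_val1 mulr1. Qed.

Lemma unit_endEr f z :
  unit_val (rhom_fun f z) = unit_val z * unit_val (rhom_fun f u1).
Proof. by rewrite -{1}[z]act_unit_one rhomE unit_val_actM. Qed.

(** An H-linear map commutes with the action of H_s, which is the action of H_t
    by right multiplications. *)
Lemma unit_endEl f z :
  unit_val (rhom_fun f z) = unit_val (rhom_fun f u1) * unit_val z.
Proof.
have <- : eps_bar (unit_val z) ▷ u1 = z.
  by apply: unit_val_inj; rewrite unit_val_eps_bar unit_val1 mul1r.
by rewrite rhomE !unit_val_eps_bar unit_val1 mul1r.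
Qed.

(** With x = f(1) one has h x = eps_t(h_1 x) h_2, where
    eps_t(h_1 x) = f(h_1 . 1) = x eps_t(h_1) by linearity and the previous lemma;
    and eps_t(h_1) h_2 = h. *)
Lemma unit_end_central f :
  unit_val (rhom_fun f u1) \in (target H :&: 'Z({: H}))%VS.
Proof.
rewrite !memv_cap unit_val_target memvf; apply/centvP => h _.
set x := unit_val _; have xT : x \in target H by apply: unit_val_target.
rewrite -(sw_eps_t_mul_target h xT).
rewrite -[in LHS](sw_eps_t_mul h) (tlift_lin (g := fun y => x * y)); last by lin.
apply: eq_tlift => a b; rewrite mulrA; congr (_ * _).
have e : eps_t H a = unit_val (a ▷ u1) by rewrite unit_val_act unit_val1 mulr1.
by rewrite e -unit_endEl rhomE unit_val_act.
Qed.

Lemma unit_end_of_central x : x \in (target H :&: 'Z({: H}))%VS ->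
  exists f, forall z, unit_val (rhom_fun f z) = unit_val z * x.
Proof.
rewrite !memv_cap => /and3P[xT _ /centvP xZ].
pose F z := tproj (unit_val z * x).
have FE z : unit_val (F z) = unit_val z * x.
  by rewrite /unit_val vsprojK // target_mul // subvsP.
exists (mk_rhom F) => z; rewrite mk_rhomE => [//||h w].
- move=> c z1 z2; rewrite /F unit_val_lin mulrDl -scalerAl.
  exact: tproj_lin.
- apply: unit_val_inj; rewrite unit_val_act !FE unit_val_act.
  have xe : eps_t H x = x by apply/targetP.
  rewrite mulrA -xZ ?memvf // -(xZ (h * _)) ?memvf //.
  by rewrite -[in RHS]xe eps_t_mull xe.
Qed.

(** * Retracts of the unit object as algebras *)

Section IdealAlgebra.
Variables (A : rep H) (i : rhom A (runit_rep H)) (p : rhom (runit_rep H) A).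
Hypothesis piK : rcomp p i = rid A.

Local Notation ival a := (unit_val (rhom_fun i a)).

Lemma ival_inj : injective (fun a => ival a).
Proof.
by move=> a b /unit_val_inj e; rewrite -[a]ridE -[b]ridE -piK !rcompE e.
Qed.

Lemma p_iK a : rhom_fun p (rhom_fun i a) = a.
Proof. by rewrite -rcompE piK ridE. Qed.

(** Locked, so that rewriting with [rcompE] does not see through it. *)
Definition ideal_mul : rhom (rten A A) A :=
  locked (rcomp (rlunit A) (rtenm i (rid A))).

Lemma ideal_mulE a b : rhom_fun ideal_mul (rpure a b) = ival a ▷ b.
Proof. by rewrite /ideal_mul -lock rcompE rtenmE rlunitE ridE. Qed.

Lemma ideal_mul_val a b :
  ival (rhom_fun ideal_mul (rpure a b)) = ival a * ival b.
Proof. by rewrite ideal_mulE rhomE unit_val_actM. Qed.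

Let e := rcomp i p.

Let eE z : rhom_fun e z = rhom_fun i (rhom_fun p z).
Proof. exact: rcompE. Qed.

Lemma ideal_one_val a : ival (rhom_fun p u1) * ival a = ival a.
Proof. by have := unit_endEl e (rhom_fun i a); rewrite !eE p_iK. Qed.

Lemma ideal_one_valr a : ival a * ival (rhom_fun p u1) = ival a.
Proof. by have := unit_endEr e (rhom_fun i a); rewrite !eE p_iK. Qed.

(** Let e also denote the element e(1) of H_t.  It acts as the identity on A, so
    (1 - e)z (x) a = (1 - e)z (x) e a, and the tensor product over H_t moves e to
    the left factor, where it becomes (1 - e)z e = 0. *)
Lemma ideal_complement_kills :
  rtenm (rid (runit_rep H) - e) (rid A) = rtenm 0 (rid A).
Proof.
apply: rhom_inj; apply: rten_ext => [||z a]; [exact: lin_rhom.. |].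
rewrite !rtenmE ridE rhom0E.
have ea : unit_val (rhom_fun e u1) ▷ a = a.
  by apply: ival_inj; rewrite rhomE unit_val_actM eE; apply: ideal_one_val.
rewrite -[in LHS]ea rtriangle; congr (rpure _ _).
apply: unit_val_inj; rewrite unit_val_eps_bar -unit_endEr.
by rewrite rhom_subE ridE linearB /= !eE p_iK subrr.
Qed.

(** The multiplication is that of H_t, and the unit is the projection of 1 : H_t
    to A.  The unit laws hold since p(z) is z e, with e(1) the neutral element of
    the ideal. *)
Definition ideal_algebra : algebra (RepH H).
Proof.
refine (@Algebra (RepH H) A ideal_mul p _ _ _).
- apply: rhom_inj; apply: rten_ext3l => [||a b c]; try by lin.
  apply: ival_inj; rewrite !rcompE rassocE !rtenmE !ridE !ideal_mul_val.
  by rewrite mulrA.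
- apply: rhom_inj; apply: rten_ext => [||z a]; try by lin.
  apply: ival_inj; rewrite !rcompE rtenmE ridE ideal_mul_val rlunitE.
  have := unit_endEr e z; rewrite !eE => ->.
  by rewrite rhomE unit_val_actM -mulrA ideal_one_val.
- apply: rhom_inj; apply: rten_ext => [||a z]; try by lin.
  apply: ival_inj; rewrite !rcompE rtenmE ridE ideal_mul_val rrunitE.
  have := unit_endEl e z; rewrite !eE => ->.
  by rewrite rhomE unit_val_eps_bar mulrA ideal_one_valr.
Defined.

End IdealAlgebra.
End UnitObject.

(** * Connectedness and separability *)

Section ConnectedSeparable.
Variables (k : fieldType) (H : weakHopf k).
Hypothesis Hss : wh_semisimple H.
Local Notation U := (runit_rep H).

Lemma unit_one_neq0 : unit_one H != 0.
Proof.
apply: contra_neq (oner_neq0 H) => e.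
by rewrite -(unit_val1 H) e /unit_val linear0.
Qed.

Lemma connectedP : wh_connected H <->
  forall f : rhom U U, exists a, forall z, rhom_fun f z = a *: z.
Proof.
split=> [Hc f|Hf].
  have := unit_end_central f; rewrite Hc => /vlineP[a e]; exists a => z.
  apply: unit_val_inj; rewrite unit_endEl e mulr_algl.
  by rewrite (linZ _ _ (@unit_val_lin k H)).
apply/eqP; rewrite eqEsubv; apply/andP; split; apply/subvP => x; last first.
  case/vlineP=> a ->; rewrite memvZ // !memv_cap memvf centv1 -(unit_val1 H).
  by rewrite unit_val_target.
move/unit_end_of_central => [f fE]; have [a fa] := Hf f; apply/vlineP; exists a.
by rewrite -[x]mul1r -(unit_val1 H) -fE fa (linZ _ _ (@unit_val_lin k H)).
Qed.

(** The unit object is simple: the projection onto the kernel of f is a scalar a,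
    and a = 0 as otherwise 1 itself would lie in the kernel. *)
Lemma connected_lker0 (M : rep H) (f : rhom U M) :
  wh_connected H -> rhom_fun f (unit_one H) != 0 -> lker (rhom_fun f) = 0%VS.
Proof.
move=> /connectedP Hc f1.
have [p [pK pid]] := stable_proj Hss (@stable_lker _ _ _ _ f).
have [a pa] := Hc p; apply/eqP; rewrite -subv0; apply/subvP => z fz.
rewrite memv0 -(pid z fz) pa; suff -> : a = 0 by rewrite scale0r.
apply: contraNeq f1 => a0; have := pK (unit_one H).
by rewrite pa memv_ker linearZ scaler_eq0 (negPf a0).
Qed.

Lemma zero_objectP (M : RepH H) :
  zero_object M <-> forall v : (M : rep H), v = 0.
Proof.
split=> [/(_ M)[[f [_ fu]] _] v|M0 N].
  have id0 : rid M = 0 by rewrite -(fu (rid M) I) (fu 0 I).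
  have := congr1 (fun g => rhom_fun g v) id0.
  by rewrite ridE rhom0E.
split; exists (0 : rhom _ _); split=> // g _; apply: rhom_inj => v.
  by rewrite (M0 v) !linear0.
by rewrite (M0 (rhom_fun g v)) rhom0E.
Qed.

(** Every a in A is the product u(1) a. *)
Lemma alg_one_neq0 (A : algebra (RepH H)) : ~ zero_object (alg_ob A) ->
  rhom_fun (alg_one A : rhom U (alg_ob A)) (unit_one H) != 0.
Proof.
move=> A0; apply/eqP => e; apply: A0; apply/zero_objectP => v.
have := congr1 (fun g : rhom (rten U (alg_ob A)) (alg_ob A) =>
  rhom_fun g (rpure (unit_one H) v)) (alg_mul1m A).
rewrite rcompE rlunitE unit_val1 ract1 rtenmE ridE e => <-.
rewrite -[X in rpure X _](scale0r 0) (linZ (f := fun x => rpure x v));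
  last by lin.
by rewrite scale0r linear0.
Qed.

Lemma separable_of_connected (A : algebra (RepH H)) :
  wh_connected H -> ~ zero_object (alg_ob A) ->
  separable_functor (free_functor A).
Proof.
move=> Hc A0; have u0 := connected_lker0 Hc (alg_one_neq0 A0).
have [p pu] := rhom_retraction Hss u0.
exact: (@split_one_separable _ A p pu).
Qed.

End ConnectedSeparable.

Lemma nonscalar_stable (k : closedFieldType) (H : weakHopf k)
    (f : rhom (runit_rep H) (runit_rep H)) :
  (~ exists a, forall z, rhom_fun f z = a *: z) ->
  exists V : {vspace runit_rep H}, [/\ stable V, V != 0%VS & V != fullv].
Proof.
move=> nf.
have [a [w [w0 fw]]] := eigenvector (rhom_fun f) (unit_one_neq0 H).
pose g := f - a *: rid (runit_rep H).
have gE z : rhom_fun g z = rhom_fun f z - a *: z.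
  by rewrite /g addrC -scaleNr rhom_funP ridE scaleNr addrC.
exists (lker (rhom_fun g)); split; first exact: stable_lker.
  apply: contra_neq w0 => K0; apply/eqP.
  by rewrite -memv0 -K0 memv_ker gE fw subrr.
apply/eqP => K1; apply: nf; exists a => z; apply/eqP.
by rewrite -subr_eq0 -gE -memv_ker K1 memvf.
Qed.

(** The algebra that contradicts separability is an eigenspace of a nonscalar
    endomorphism of the unit object. *)
Lemma connected_of_separable (k : closedFieldType) (H : weakHopf k)
    (Hss : wh_semisimple H) :
  (forall A : algebra (RepH H),
     ~ zero_object (alg_ob A) -> separable_functor (free_functor A)) ->
  wh_connected H.
Proof.
move=> sep; apply/connectedP => f; apply: contrapT => /nonscalar_stable.
case=> V [hV V0 V1]; have [q [qV qid]] := stable_proj Hss hV.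
pose U := runit_rep H; pose A := subrep hV.
pose i : rhom A U := mk_rhom (@sub_val _ _ _ _ hV).
have iE v : rhom_fun i v = sub_val v.
  by rewrite mk_rhomE // => h w; rewrite sub_val_act.
pose p : rhom U A := mk_rhom (fun z => sub_proj hV (rhom_fun q z)).
have pE z : sub_val (rhom_fun p z) = rhom_fun q z.
  rewrite mk_rhomE ?sub_projK // => [|h w].
    by apply: (lin_comp (@sub_proj_lin _ _ _ _ _)); lin.
  by apply: sub_val_inj; rewrite sub_val_act !sub_projK // rhomE.
have piK : rcomp p i = rid A.
  apply: rhom_inj => v; rewrite rcompE ridE; apply: sub_val_inj.
  by rewrite pE iE qid // sub_val_mem.
have /sep sepA : ~ zero_object (alg_ob (ideal_algebra piK)).
  move/zero_objectP => A0; move/negP: V0; apply; rewrite -subv0.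
  apply/subvP => v Vv; rewrite memv0 -(sub_projK hV Vv).
  by rewrite (A0 (sub_proj hV v)) /sub_val linear0.
have q1 : rid U - rcomp i p = 0 :=
  separable_faithful sepA (ideal_complement_kills piK).
move/negP: V1; apply; rewrite eqEsubv subvf; apply/subvP => z _.
have /eqP := congr1 (fun h => rhom_fun h z) q1.
rewrite rhom_subE ridE rcompE iE pE rhom0E subr_eq0 => /eqP ->.
exact: qV.
Qed.

Theorem proposition6p1 (k : closedFieldType) (C : linMonCategory k)
    (C_multifusion : multifusion C)
    (H : weakHopf k) (H_regular : wh_regular H) (H_semisimple : wh_semisimple H)
    (C_RepH : monoidally_equivalent C (RepH H)) :
  wh_connected H <->
  (forall A : algebra (RepH H),
     ~ zero_object (alg_ob A) -> separable_functor (free_functor A)).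
Proof.
split=> [Hc A|]; first exact: (separable_of_connected H_semisimple).
exact: (connected_of_separable H_semisimple).
Qed.
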